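(* Let $d>0$ be real. Then the set $\mathcal{G}$ has exactly one element. That is, there is exactly one $u_0>0$ such that the solution $(u,V)$ of $$u''+\frac{d-1}{r}\,u'=(V-1)u,\qquad V''+\frac{d-1}{r}\,V'=u^2,\qquad u(0)=u_0,\ u'(0)=0,\ V(0)=0,\ V'(0)=0,$$ exists on $[0,\infty[$ and satisfies $u(r)\ge 0$ for all $r\geq 0$ and $\lim_{r\to\infty}u(r)=0$.
   Context: $\mathcal{G}$ denotes the set of all $u_0>0$ such that the solution $(u,V)$ of the stated initial value problem exists on $[0,\infty[$, satisfies $u\ge 0$, and $\lim_{r\to\infty}u(r)=0$. The parameter $d>0$ is real (not necessarily an integer). A solution on an interval $[0,R[$ ($0<R\le\infty$) is a pair of real-valued functions $(u,V)$ that are $C^2$ on $[0,R[$, satisfy the differential equations on $]0,R[$ and satisfy the initial conditions at $r=0$; equivalently, $u$ and $V$ are continuous on $[0,R[$ with $u(0)=u_0$, $V(0)=0$, and for $r\in\,]0,R[$, $$u'(r)=r^{1-d}\int_0^r (V(s)-1)u(s)s^{d-1}\,ds,\qquad V'(r)=r^{1-d}\int_0^r u(s)^2s^{d-1}\,ds .$$ For each $u_0$ the solution is unique on its maximal interval of existence. *)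

(* Defs.v *)
From Stdlib Require Import Reals.
From Coquelicot Require Import Coquelicot.
Open Scope R_scope.

(** The half-open interval [0, b[, where b may be [p_infty]. *)
Definition Ico0 (b : Rbar) (r : R) : Prop := 0 <= r /\ Rbar_lt r b.

(** [f] is C^2 on [D], with first and second derivatives [f1] and [f2].
    [D_in] and [continue_in] are relative to [D], hence one-sided at a boundary
    point of [D] and two-sided at an interior point; the values of [f], [f1]
    and [f2] outside [D] are irrelevant. *)
Definition C2_on (D : R -> Prop) (f f1 f2 : R -> R) : Prop :=
  forall r, D r -> D_in f f1 D r /\ D_in f1 f2 D r /\ continue_in f2 D r.

Definition is_solution (d u0 : R) (b : Rbar) (u V : R -> R) : Prop :=
  exists u1 u2 V1 V2 : R -> R,
    C2_on (Ico0 b) u u1 u2 /\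
    C2_on (Ico0 b) V V1 V2 /\
    (forall r, 0 < r -> Rbar_lt r b ->
       u2 r + (d - 1) / r * u1 r = (V r - 1) * u r /\
       V2 r + (d - 1) / r * V1 r = u r ^ 2) /\
    u 0 = u0 /\ u1 0 = 0 /\ V 0 = 0 /\ V1 0 = 0.

Definition G (d u0 : R) : Prop :=
  0 < u0 /\
  exists u V : R -> R,
    is_solution d u0 p_infty u V /\
    (forall r, 0 <= r -> 0 <= u r) /\
    is_lim u p_infty 0.

(* Main.v *)
Require Import Defs.
From Stdlib Require Import Reals Lra Lia Psatz Classical.
From Coquelicot Require Import Coquelicot.
Open Scope R_scope.

(** Write [D] for the radial Laplacian and [W = V - 1], so that [D u = W u], [D W = u^2].

    Uniqueness. The function [h = u + W] satisfies [D h = u h], so it keeps its sign and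
    grows in absolute value. If [u0 < 1], then [W <= -(1 - u0)] and [u] oscillates, so
    [u0 >= 1] for a ground state. Let [u0 < v0] be two ground states, with potentials [P]
    and [Q]. The Wronskian [g = r^(d-1) (v' u - u' v)] has derivative
    [r^(d-1) (Q - P) u v], which is nonnegative as long as [u < v]; hence [u < v] persists
    and [g] stays above a positive constant. As [v0 > 1], [Q - 1] is eventually at least some
    [c > 0], so that [r^(d-1) (u' + v'/c)] is eventually nondecreasing, [r^(d-1) u'] is
    bounded below and, since [u', v' <= 0], [g <= C v -> 0], a contradiction.

    Existence. Replacing [u] by its truncation to [[0, M]] on the right-hand sides gives a
    problem that Picard iteration solves on the whole half-line, with Lipschitz dependence on
    [u(0) = a]. The sets of [a] for which [u] takes a negative value, or increases
    somewhere, are open and disjoint; a solution with [a <= M] in neither set is a ground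
    state. For [a < 1] a solution is nonincreasing as long as it is nonnegative, and for
    large [M] the solution with [a = M] is not nonincreasing. *)

(** * Calculus on the half-line *)

Lemma nondecreasing_of_derive (f f' : R -> R) (a b : R) :
  a <= b ->
  (forall x, a <= x <= b -> is_derive f x (f' x)) ->
  (forall x, a < x < b -> 0 <= f' x) -> f a <= f b.
Proof.
intros ab df pos.
destruct (Rle_lt_or_eq_dec a b ab) as [lt | ->]; [|lra].
destruct (MVT_cor2 f f' a b lt) as [c [e cab]].
- intros c hc; apply is_derive_Reals, df, hc.
- specialize (pos c cab); nra.
Qed.

Lemma increasing_of_derive (f f' : R -> R) (a b : R) :
  a < b ->
  (forall x, a <= x <= b -> is_derive f x (f' x)) ->
  (forall x, a < x < b -> 0 < f' x) -> f a < f b.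
Proof.
intros lt df pos.
destruct (MVT_cor2 f f' a b lt) as [c [e cab]].
- intros c hc; apply is_derive_Reals, df, hc.
- specialize (pos c cab); nra.
Qed.

Lemma at_right_0_spec (f : R -> R) (l : R) :
  filterlim f (at_right 0) (locally l) <->
  forall eps, 0 < eps ->
  exists delta, 0 < delta /\ forall r, 0 < r < delta -> Rabs (f r - l) < eps.
Proof.
split.
- intros lim eps he.
  destruct (proj1 (filterlim_locally f l) lim (mkposreal eps he)) as [dl hd].
  exists dl; split; [apply cond_pos|].
  intros r hr; apply hd; [|lra].
  change (Rabs (r - 0) < dl); rewrite Rabs_right; lra.
- intros lim; apply filterlim_locally; intros eps.
  destruct (lim eps (cond_pos eps)) as [dl [hd h]].
  exists (mkposreal dl hd); intros y hy y0.
  apply h; change (Rabs (y - 0) < dl) in hy.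
  rewrite Rabs_right in hy; lra.
Qed.

Lemma at_right_0_lincomb (f g : R -> R) (a b l m : R) :
  filterlim f (at_right 0) (locally l) -> filterlim g (at_right 0) (locally m) ->
  filterlim (fun r => a * f r + b * g r) (at_right 0) (locally (a * l + b * m)).
Proof.
intros hf hg.
eapply filterlim_comp_2; [| |apply (filterlim_plus (a * l) (b * m))].
- eapply filterlim_comp; [exact hf|apply (filterlim_scal_r a l)].
- eapply filterlim_comp; [exact hg|apply (filterlim_scal_r b m)].
Qed.

(** The flux [r^(d-1) f'(r)] is controlled at [0] only through its limit from the right, which
    therefore takes the place of the value at the left endpoint. If [f b < l], then [f s > f b] for
    some small [s], against monotonicity on [[s, b]]. *)
Lemma ge_limit_of_derive (f f' : R -> R) (l b : R) :
  0 < b ->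
  (forall x, 0 < x <= b -> is_derive f x (f' x)) ->
  filterlim f (at_right 0) (locally l) ->
  (forall x, 0 < x < b -> 0 <= f' x) -> l <= f b.
Proof.
intros b0 df lim pos.
destruct (Rle_or_lt l (f b)) as [|lt]; [easy|exfalso].
destruct (proj1 (at_right_0_spec f l) lim (l - f b) ltac:(lra)) as [dl [d0 hd]].
pose (s := Rmin (dl / 2) (b / 2)).
assert (hs : 0 < s < dl /\ s < b).
{ unfold s; repeat split; try apply Rmin_glb_lt; try lra.
  - apply Rle_lt_trans with (1 := Rmin_l _ _); lra.
  - apply Rle_lt_trans with (1 := Rmin_r _ _); lra. }
specialize (hd s (proj1 hs)).
assert (f s <= f b).
{ apply (nondecreasing_of_derive f f'); [lra| |].
  - intros x hx; apply df; lra.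
  - intros x hx; apply pos; lra. }
apply Rabs_def2 in hd; lra.
Qed.

Lemma gt_limit_of_derive (f f' : R -> R) (l b : R) :
  0 < b ->
  (forall x, 0 < x <= b -> is_derive f x (f' x)) ->
  filterlim f (at_right 0) (locally l) ->
  (forall x, 0 < x < b -> 0 < f' x) -> l < f b.
Proof.
intros b0 df lim pos.
apply Rle_lt_trans with (f (b / 2)).
- apply (ge_limit_of_derive f f'); [lra| |exact lim|].
  + intros x hx; apply df; lra.
  + intros x hx; apply Rlt_le, pos; lra.
- apply (increasing_of_derive f f'); [lra| |].
  + intros x hx; apply df; lra.
  + intros x hx; apply pos; lra.
Qed.

Lemma Rpower_small (d eps : R) : 0 < d -> 0 < eps ->
  exists delta, 0 < delta /\ forall r, 0 < r < delta -> Rpower r d < eps.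
Proof.
intros d0 e0.
exists (Rpower eps (/ d)); split; [apply exp_pos|].
intros r hr.
replace eps with (Rpower (Rpower eps (/ d)) d) at 1.
- apply Rlt_Rpower_l; lra.
- rewrite Rpower_mult, Rinv_l, Rpower_1; lra.
Qed.

Lemma is_derive_Rpower (d r : R) : 0 < r ->
  is_derive (fun s => Rpower s d) r (d * Rpower r (d - 1)).
Proof. now intros r0; apply is_derive_Reals, derivable_pt_lim_power. Qed.

Lemma Rpower_succ (d r : R) : 0 < r -> Rpower r d = Rpower r (d - 1) * r.
Proof.
intros r0; rewrite <- (Rpower_1 r) at 3 by easy.
rewrite <- Rpower_plus; f_equal; ring.
Qed.

(** The point [c] is the supremum of the [x] with [f > 0] on [[0, x]]. At [0] only the limit from
    the right is assumed, as [radial] provides no more. *)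
Lemma first_zero (f : R -> R) (b : R) :
  (forall r, 0 < r -> continuity_pt f r) ->
  filterlim f (at_right 0) (locally (f 0)) ->
  0 < f 0 -> 0 <= b -> f b <= 0 ->
  exists c, 0 < c <= b /\ f c = 0 /\ forall r, 0 <= r < c -> 0 < f r.
Proof.
intros cf lim f0 b0 fb.
pose (E := fun x => 0 <= x <= b /\ forall r, 0 <= r <= x -> 0 < f r).
assert (bE : bound E) by (exists b; intros x [hx _]; lra).
assert (nE : exists x, E x).
{ exists 0; split; [lra|]; intros r hr; now replace r with 0 by lra. }
destruct (completeness E bE nE) as [c [ub lub]].
assert (below : forall r, 0 <= r < c -> 0 < f r).
{ intros r hr; destruct (Rlt_or_le 0 (f r)) as [|le]; [easy|exfalso].
  assert (c <= r); [|lra].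
  apply lub; intros x [hx px].
  destruct (Rle_or_lt x r); [easy|].
  specialize (px r ltac:(lra)); lra. }
assert (c0 : 0 < c).
{ destruct (proj1 (at_right_0_spec f (f 0)) lim (f 0) f0) as [dl [d0 hd]].
  assert (m : Rmin (dl / 2) b <= c).
  { apply ub; split.
    - split; [apply Rmin_glb; lra|apply Rmin_r].
    - intros r hr.
      destruct (Rle_lt_or_eq_dec 0 r (proj1 hr)) as [r0 | <-]; [|easy].
      pose proof (Rmin_l (dl / 2) b).
      specialize (hd r ltac:(lra)); apply Rabs_def2 in hd; lra. }
  assert (b <> 0) by (intros ->; lra).
  apply Rlt_le_trans with (2 := m); apply Rmin_glb_lt; lra. }
assert (cb : c <= b) by (apply lub; intros x [hx _]; lra).
exists c; split; [lra|]; split; [|easy].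
destruct (Rtotal_order (f c) 0) as [neg | [z | pos]]; [exfalso| easy |exfalso].
- destruct (cf c c0 (- f c) ltac:(lra)) as [al [a0 ha]].
  pose (s := Rmax (c / 2) (c - al / 2)).
  assert (hs : c / 2 <= s /\ c - al / 2 <= s /\ s < c).
  { unfold s; repeat split; [apply Rmax_l|apply Rmax_r|apply Rmax_lub_lt; lra]. }
  assert (h : R_dist (f s) (f c) < - f c).
  { apply ha; split; [split; [exact I|lra]|].
    apply Rabs_def1; lra. }
  apply Rabs_def2 in h; specialize (below s ltac:(lra)); lra.
- assert (cltb : c < b) by (destruct cb as [|cb]; [easy|subst; lra]).
  destruct (cf c c0 (f c) ltac:(lra)) as [al [a0 ha]].
  pose (s := Rmin b (c + al / 2)).
  assert (hs : s <= b /\ s <= c + al / 2 /\ c < s).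
  { unfold s; repeat split; [apply Rmin_l|apply Rmin_r|apply Rmin_glb_lt; lra]. }
  assert (E s); [|assert (s <= c) by (now apply ub); lra].
  split; [lra|]; intros r hr.
  destruct (Rlt_or_le r c); [apply below; lra|].
  destruct (Req_dec r c) as [-> | ne]; [easy|].
  assert (h : R_dist (f r) (f c) < f c).
  { apply ha; split; [split; [exact I|lra]|].
    apply Rabs_def1; lra. }
  apply Rabs_def2 in h; lra.
Qed.

(** * The radial Laplacian *)

(* Coquelicot's lemmas leave equations in structures that unfold to [R], which [ring] and
   [field] do not recognize. *)
Ltac eq_R := match goal with |- @eq _ ?a ?b => change (@eq R a b) end.
Ltac ring_R := eq_R; ring.
Ltac field_R := eq_R; field.

Definition flux (d : R) (f1 : R -> R) (r : R) : R := Rpower r (d - 1) * f1 r.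

(** [f'' + (d-1)/r f' = F] on the half-line with [f' = f1], in divergence form;
    the last clause replaces [f' 0 = 0]. *)
Definition radial (d : R) (f f1 F : R -> R) : Prop :=
  (forall r, 0 < r -> is_derive f r (f1 r)) /\
  (forall r, 0 < r -> is_derive (flux d f1) r (Rpower r (d - 1) * F r)) /\
  filterlim f (at_right 0) (locally (f 0)) /\
  filterlim (flux d f1) (at_right 0) (locally 0).

Lemma Rpower_pos (x y : R) : 0 < Rpower x y.
Proof. apply exp_pos. Qed.

Lemma flux_pos (d : R) (f1 : R -> R) (r : R) : 0 < flux d f1 r <-> 0 < f1 r.
Proof.
unfold flux; pose proof (Rpower_pos r (d - 1)); split; intros h.
- apply Rmult_lt_reg_l with (1 := H); lra.
- now apply Rmult_lt_0_compat.
Qed.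

Lemma flux_nonneg (d : R) (f1 : R -> R) (r : R) : 0 <= flux d f1 r <-> 0 <= f1 r.
Proof.
unfold flux; pose proof (Rpower_pos r (d - 1)); split; intros h.
- apply Rmult_le_reg_l with (1 := H); lra.
- apply Rmult_le_pos; lra.
Qed.

Lemma is_derive_eq (f : R -> R) (x l l' : R) :
  is_derive f x l -> l = l' -> is_derive f x l'.
Proof. now intros h <-. Qed.

(** The bound [|f1| <= C r] makes the flux [O(r^d)], hence infinitesimal for every [d > 0], although
    [r^(d-1)] blows up at [0] when [d < 1]. *)
Lemma radial_intro (d : R) (f f1 f2 F : R -> R) (C dl : R) : 0 < d ->
  (forall r, 0 < r -> is_derive f r (f1 r)) ->
  (forall r, 0 < r -> is_derive f1 r (f2 r)) ->
  (forall r, 0 < r -> f2 r + (d - 1) / r * f1 r = F r) ->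
  filterlim f (at_right 0) (locally (f 0)) ->
  0 < dl -> (forall r, 0 < r < dl -> Rabs (f1 r) <= C * r) ->
  radial d f f1 F.
Proof.
intros d0 df df1 eq lim dl0 bd; split; [easy|split; [|split; [easy|]]].
- intros r r0; unfold flux.
  eapply is_derive_eq.
  { apply (is_derive_mult (fun s => Rpower s (d - 1)) f1).
    - now apply is_derive_Rpower.
    - now apply df1.
    - intros n m; apply Rmult_comm. }
  rewrite <- (eq r r0), (Rpower_succ (d - 1) r r0).
  unfold plus, mult; simpl; field; lra.
- apply at_right_0_spec; intros eps e0.
  assert (C0 : 0 <= C).
  { specialize (bd (dl / 2) ltac:(lra)).
    pose proof (Rabs_pos (f1 (dl / 2))); nra. }
  destruct (Rpower_small d (eps / (C + 1)) d0) as [dl' [h1 h2]].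
  { apply Rdiv_lt_0_compat; lra. }
  exists (Rmin dl dl'); split; [now apply Rmin_glb_lt|].
  intros r [r0 hr].
  assert (r < dl /\ r < dl') as [rl rl'].
  { split; apply Rlt_le_trans with (1 := hr); [apply Rmin_l|apply Rmin_r]. }
  specialize (h2 r ltac:(lra)); specialize (bd r ltac:(lra)).
  unfold flux; rewrite Rminus_0_r, Rabs_mult, (Rabs_right (Rpower _ _)).
  2: apply Rle_ge, Rlt_le, Rpower_pos.
  rewrite (Rpower_succ d r r0) in h2.
  pose proof (Rpower_pos r (d - 1)).
  apply Rle_lt_trans with ((C + 1) * (Rpower r (d - 1) * r)).
  + replace ((C + 1) * (Rpower r (d - 1) * r))
      with (Rpower r (d - 1) * (C * r + r)) by ring.
    apply Rmult_le_compat_l; lra.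
  + apply Rmult_lt_compat_l with (r := C + 1) in h2; [|lra].
    replace ((C + 1) * (eps / (C + 1))) with eps in h2 by (field; lra); lra.
Qed.

(** Comparison functions are built as linear combinations of solutions and barriers; [-f] appears as
    [-1 * f + 0 * f]. *)
Lemma radial_lincomb (d a b : R) (f f1 F g g1 G : R -> R) :
  radial d f f1 F -> radial d g g1 G ->
  radial d (fun r => a * f r + b * g r) (fun r => a * f1 r + b * g1 r)
    (fun r => a * F r + b * G r).
Proof.
intros [f_1 [f_2 [f_3 f_4]]] [g_1 [g_2 [g_3 g_4]]]; split; [|split; [|split]].
- intros r r0.
  apply (is_derive_plus (fun r => a * f r) (fun r => b * g r));
    now apply is_derive_scal; auto.
- intros r r0.
  apply is_derive_ext with (fun r => a * flux d f1 r + b * flux d g1 r).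
  { intros t; unfold flux; ring_R. }
  apply is_derive_eq with
    (a * (Rpower r (d - 1) * F r) + b * (Rpower r (d - 1) * G r)); [|ring].
  apply (is_derive_plus (fun r => a * flux d f1 r) (fun r => b * flux d g1 r));
    now apply is_derive_scal; auto.
- now apply at_right_0_lincomb.
- apply filterlim_ext with (fun r => a * flux d f1 r + b * flux d g1 r).
  { intros t; unfold flux; ring_R. }
  replace 0 with (a * 0 + b * 0) at 2 by ring.
  now apply at_right_0_lincomb.
Qed.

Lemma filterlim_at_right_of_continuous (f : R -> R) (a : R) :
  continuous f a -> filterlim f (at_right a) (locally (f a)).
Proof. intros h; apply filterlim_filter_le_1 with (2 := h), filter_le_within. Qed.

Lemma radial_const (d c : R) : 0 < d -> radial d (fun _ => c) (fun _ => 0) (fun _ => 0).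
Proof.
intros d0; apply (radial_intro d _ _ (fun _ => 0) _ 0 1); try easy; try lra.
- intros; apply @is_derive_const.
- intros; apply @is_derive_const.
- intros; ring.
- apply filterlim_const.
- intros; rewrite Rabs_R0; lra.
Qed.

(** The functions [r^2] and [r^4] serve as barriers: comparison with their multiples turns bounds on
    a radial Laplacian into polynomial bounds. *)
Lemma radial_sq (d : R) : 0 < d ->
  radial d (fun r => r ^ 2) (fun r => 2 * r) (fun _ => 2 * d).
Proof.
intros d0; apply (radial_intro d _ _ (fun _ => 2) _ 2 1); try easy; try lra.
- intros; auto_derive; [easy|ring].
- intros; auto_derive; [easy|ring].
- intros; field; lra.
- apply (filterlim_at_right_of_continuous (fun r => r ^ 2)).
  apply (ex_derive_continuous (fun r => r ^ 2)); auto_derive; easy.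
- intros; rewrite Rabs_right; lra.
Qed.

Lemma radial_quartic (d : R) : 0 < d ->
  radial d (fun r => r ^ 4) (fun r => 4 * r ^ 3) (fun r => 4 * (d + 2) * r ^ 2).
Proof.
intros d0; apply (radial_intro d _ _ (fun r => 12 * r ^ 2) _ 4 1); try easy; try lra.
- intros; auto_derive; [easy|ring].
- intros; auto_derive; [easy|ring].
- intros; field; lra.
- apply (filterlim_at_right_of_continuous (fun r => r ^ 4)).
  apply (ex_derive_continuous (fun r => r ^ 4)); auto_derive; easy.
- intros r hr; assert (0 < r ^ 3 <= r).
  { split; [apply pow_lt; lra|simpl; nra]. }
  rewrite Rabs_right; lra.
Qed.

Lemma radial_continuity_pt (d : R) (f f1 F : R -> R) (r : R) :
  radial d f f1 F -> 0 < r -> continuity_pt f r.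
Proof.
intros [h _] r0; apply continuity_pt_filterlim.
apply (ex_derive_continuous f); eexists; now apply h.
Qed.

Lemma radial_flux_mono (d : R) (f f1 F : R -> R) (s r : R) :
  radial d f f1 F -> 0 < s <= r -> (forall t, s < t < r -> 0 <= F t) ->
  flux d f1 s <= flux d f1 r.
Proof.
intros [_ [h _]] sr pos.
apply (nondecreasing_of_derive _ (fun r => Rpower r (d - 1) * F r)); [lra| |].
- intros x hx; apply h; lra.
- intros x hx; apply Rmult_le_pos; [apply Rlt_le, Rpower_pos|auto].
Qed.

(** The flux tends to [0] at the origin, so it inherits the sign of its derivative. *)
Lemma radial_derive_nonneg (d : R) (f f1 F : R -> R) (r : R) :
  radial d f f1 F -> 0 < r -> (forall t, 0 < t < r -> 0 <= F t) -> 0 <= f1 r.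
Proof.
intros [_ [h [_ l]]] r0 pos; apply (flux_nonneg d).
apply (ge_limit_of_derive _ (fun r => Rpower r (d - 1) * F r)); try easy.
- intros x hx; apply h; lra.
- intros x hx; apply Rmult_le_pos; [apply Rlt_le, Rpower_pos|auto].
Qed.

Lemma radial_derive_pos (d : R) (f f1 F : R -> R) (r : R) :
  radial d f f1 F -> 0 < r -> (forall t, 0 < t < r -> 0 < F t) -> 0 < f1 r.
Proof.
intros [_ [h [_ l]]] r0 pos; apply (flux_pos d).
apply (gt_limit_of_derive _ (fun r => Rpower r (d - 1) * F r)); try easy.
- intros x hx; apply h; lra.
- intros x hx; apply Rmult_lt_0_compat; [apply Rpower_pos|auto].
Qed.

Lemma nondecreasing_on_half_line (f f1 : R -> R) (s r : R) :
  (forall t, 0 < t -> is_derive f t (f1 t)) ->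
  filterlim f (at_right 0) (locally (f 0)) ->
  0 <= s <= r -> (forall t, s < t < r -> 0 <= f1 t) -> f s <= f r.
Proof.
intros df lim sr pos.
destruct (Rle_lt_or_eq_dec 0 s (proj1 sr)) as [s0 | <-].
- apply (nondecreasing_of_derive f f1); [lra| |easy].
  intros x hx; apply df; lra.
- destruct (Rle_lt_or_eq_dec 0 r (proj2 sr)) as [r0 | <-]; [|lra].
  apply (ge_limit_of_derive f f1); try easy.
  intros x hx; apply df; lra.
Qed.

Lemma increasing_on_half_line (f f1 : R -> R) (s r : R) :
  (forall t, 0 < t -> is_derive f t (f1 t)) ->
  filterlim f (at_right 0) (locally (f 0)) ->
  0 <= s < r -> (forall t, s < t < r -> 0 < f1 t) -> f s < f r.
Proof.
intros df lim sr pos.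
destruct (Rle_lt_or_eq_dec 0 s (proj1 sr)) as [s0 | <-].
- apply (increasing_of_derive f f1); [lra| |easy].
  intros x hx; apply df; lra.
- apply (gt_limit_of_derive f f1); try easy.
  intros x hx; apply df; lra.
Qed.

Lemma radial_nondecreasing (d : R) (f f1 F : R -> R) (b s r : R) :
  radial d f f1 F -> 0 <= s <= r -> r <= b ->
  (forall t, 0 < t < b -> 0 <= F t) -> f s <= f r.
Proof.
intros h sr rb pos.
apply (nondecreasing_on_half_line f f1); [apply h|apply h|easy|].
intros t ht; apply (radial_derive_nonneg d f f1 F); [easy|lra|].
intros; apply pos; lra.
Qed.

(** A maximum principle: up to a first zero [c] the function [f] would be nondecreasing, so
    [f 0 <= f c = 0]. *)
Lemma radial_sign_preserved (d : R) (f f1 F : R -> R) :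
  radial d f f1 F -> 0 < f 0 ->
  (forall t, 0 < t -> 0 < f t -> 0 <= F t) ->
  forall r, 0 <= r -> f 0 <= f r.
Proof.
intros h f0 pos.
assert (allpos : forall r, 0 <= r -> 0 < f r).
{ intros r r0; apply Rnot_le_lt; intros fr.
  destruct (first_zero f r) as [c [c0 [fc below]]]; try easy.
  - intros t t0; apply (radial_continuity_pt d f f1 F); easy.
  - apply h.
  - assert (f 0 <= f c); [|lra].
    apply (radial_nondecreasing d f f1 F c); [easy|lra|lra|].
    intros t ht; apply pos; [lra|apply below; lra]. }
intros r r0; apply (radial_nondecreasing d f f1 F r); [easy|lra|lra|].
intros t ht; apply pos; [lra|apply allpos; lra].
Qed.

(** The quartic term comes from [V r >= l^2 r^2 / (2 d)]. *)
Lemma radial_growth (d l A b : R) (u u1 V V1 g : R -> R) : 0 < d -> 0 <= l -> 0 <= b ->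
  radial d u u1 (fun r => (V r - 1) * g r) -> radial d V V1 (fun r => g r ^ 2) ->
  V 0 = 0 -> (forall r, 0 < r < b -> l <= g r <= A) ->
  u 0 + l ^ 3 * b ^ 4 / (8 * d * (d + 2)) - A * b ^ 2 / (2 * d) <= u b.
Proof.
intros d0 l0 b0 hu hV V0 bd.
assert (Vge : forall r, 0 <= r <= b -> l ^ 2 / (2 * d) * r ^ 2 <= V r).
{ intros r hr.
  pose proof (radial_lincomb d 1 (- (l ^ 2 / (2 * d))) _ _ _ _ _ _ hV (radial_sq d d0)) as h.
  assert (H := radial_nondecreasing d _ _ _ b 0 r h ltac:(lra) ltac:(lra)).
  simpl in H; rewrite V0 in H.
  assert (0 <= V r - l ^ 2 / (2 * d) * r ^ 2); [|lra].
  eapply Rle_trans; [|eapply Rle_trans; [apply H|]].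
  - right; ring.
  - intros t ht; specialize (bd t ht).
    replace (- (l * (l * 1) / (2 * d)) * (2 * d)) with (- (l * l)) by (field; lra); nra.
  - right; simpl; ring. }
(* With these constants [k r^4] and [m r^2] have Laplacians [l^3 r^2 / (2 d)] and [A], so
   [u - k r^4 + m r^2] has Laplacian [V g - l^3 r^2 / (2 d) + (A - g) >= 0]. *)
pose (k := l ^ 3 / (8 * d * (d + 2))).
pose (m := A / (2 * d)).
pose proof (radial_lincomb d (- k) m _ _ _ _ _ _
  (radial_quartic d d0) (radial_sq d d0)) as h.
pose proof (radial_lincomb d 1 1 _ _ _ _ _ _ hu h) as h'.
assert (H := radial_nondecreasing d _ _ _ b 0 b h' ltac:(lra) ltac:(lra)).
simpl in H.
replace (u 0 + l ^ 3 * b ^ 4 / (8 * d * (d + 2)) - A * b ^ 2 / (2 * d))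
  with (u 0 + k * b ^ 4 - m * b ^ 2) by (unfold k, m; field; lra).
enough (1 * u 0 + 1 * (- k * (0 * (0 * (0 * (0 * 1)))) + m * (0 * (0 * 1))) <=
  1 * u b + 1 * (- k * (b * (b * (b * (b * 1)))) + m * (b * (b * 1)))) by (simpl; lra).
apply H; intros t ht; specialize (bd t ht); specialize (Vge t ltac:(lra)).
replace (1 * (- k * (4 * (d + 2) * (t * (t * 1))) + m * (2 * d)))
  with (A - l * (l ^ 2 / (2 * d) * t ^ 2)) by (unfold k, m; field; lra).
assert (0 <= l ^ 2 / (2 * d) * t ^ 2).
{ apply Rmult_le_pos; [|apply pow2_ge_0].
  apply Rdiv_le_0_compat; [apply pow2_ge_0|lra]. }
set (w := l ^ 2 / (2 * d) * t ^ 2) in *; nra.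
Qed.

(** * Uniqueness *)

Lemma is_derive_of_D_in (f f1 : R -> R) (r : R) :
  D_in f f1 (Ico0 p_infty) r -> 0 < r -> is_derive f r (f1 r).
Proof.
intros h r0; apply is_derive_Reals; intros eps e0.
destruct (h eps e0) as [al [a0 ha]].
assert (m0 : 0 < Rmin al r) by (apply Rmin_glb_lt; lra).
exists (mkposreal _ m0); intros x x0 hx; simpl in hx.
pose proof (Rmin_l al r); pose proof (Rmin_r al r).
specialize (ha (r + x)); simpl in ha; unfold R_dist, D_x, Ico0 in ha.
replace (r + x - r) with x in ha by ring.
apply ha; split; [|lra].
apply Rabs_def2 in hx; split; [split; [lra|exact I]|lra].
Qed.

(** Applied to a function, this gives its limit at [0]; applied to its derivative, which vanishes at
    [0], it gives the bound [|f1| <= C r] wanted by [radial_intro]. *)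
Lemma lipschitz_at_0_of_D_in (f f1 : R -> R) :
  D_in f f1 (Ico0 p_infty) 0 ->
  exists C delta, 0 < delta /\ forall r, 0 < r < delta -> Rabs (f r - f 0) <= C * r.
Proof.
intros h; destruct (h 1 ltac:(lra)) as [al [a0 ha]].
exists (Rabs (f1 0) + 1), al; split; [easy|]; intros r hr.
specialize (ha r); simpl in ha; unfold R_dist, D_x, Ico0 in ha.
rewrite Rminus_0_r in ha.
assert (hq : Rabs ((f r - f 0) / r - f1 0) < 1).
{ apply ha; split; [|rewrite Rabs_right; lra].
  split; [split; [lra|exact I]|lra]. }
replace (f r - f 0) with ((f1 0 + ((f r - f 0) / r - f1 0)) * r) by (field; lra).
rewrite Rabs_mult, (Rabs_right r) by lra.
apply Rmult_le_compat_r; [lra|].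
eapply Rle_trans; [apply Rabs_triang|lra].
Qed.

Lemma at_right_0_of_lipschitz (f : R -> R) (C dl : R) : 0 < dl ->
  (forall r, 0 < r < dl -> Rabs (f r - f 0) <= C * r) ->
  filterlim f (at_right 0) (locally (f 0)).
Proof.
intros d0 h; apply at_right_0_spec; intros eps e0.
assert (C0 : 0 <= C).
{ specialize (h (dl / 2) ltac:(lra)); pose proof (Rabs_pos (f (dl / 2) - f 0)); nra. }
assert (p : 0 < eps / (C + 1)) by (apply Rdiv_lt_0_compat; lra).
exists (Rmin dl (eps / (C + 1))); split; [now apply Rmin_glb_lt|].
intros r [r0 hr].
pose proof (Rmin_l dl (eps / (C + 1))); pose proof (Rmin_r dl (eps / (C + 1))).
apply Rle_lt_trans with (1 := h r ltac:(lra)).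
assert (r < eps / (C + 1)) as hr' by lra.
apply Rmult_lt_compat_l with (r := C + 1) in hr'; [|lra].
replace ((C + 1) * (eps / (C + 1))) with eps in hr' by (field; lra); lra.
Qed.

Lemma radial_of_C2_on (d : R) (f f1 f2 F : R -> R) : 0 < d ->
  C2_on (Ico0 p_infty) f f1 f2 -> f1 0 = 0 ->
  (forall r, 0 < r -> f2 r + (d - 1) / r * f1 r = F r) ->
  radial d f f1 F.
Proof.
intros d0 h z eq.
assert (dom : forall r, 0 <= r -> Ico0 p_infty r) by (intros; split; easy).
destruct (h 0 (dom 0 ltac:(lra))) as [h0 [h1 _]].
destruct (lipschitz_at_0_of_D_in _ _ h0) as [C0 [dl0 [p0 b0]]].
destruct (lipschitz_at_0_of_D_in _ _ h1) as [C1 [dl1 [p1 b1]]].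
apply (radial_intro d f f1 f2 F C1 dl1); try easy.
- intros r r0; apply is_derive_of_D_in; [apply h, dom; lra|easy].
- intros r r0; apply is_derive_of_D_in; [apply h, dom; lra|easy].
- now apply (at_right_0_of_lipschitz f C0 dl0).
- intros r hr; rewrite <- (Rminus_0_r (f1 r)), <- z; now apply b1.
Qed.

Definition ground_state (d u0 : R) (u u1 V V1 : R -> R) : Prop :=
  radial d u u1 (fun r => (V r - 1) * u r) /\ radial d V V1 (fun r => u r ^ 2) /\
  u 0 = u0 /\ V 0 = 0 /\ 0 < u0 /\ (forall r, 0 <= r -> 0 <= u r) /\ is_lim u p_infty 0.

Lemma ground_state_of_G (d u0 : R) : 0 < d -> G d u0 ->
  exists u u1 V V1, ground_state d u0 u u1 V V1.
Proof.
intros d0 [u0p [u [V [[u1 [u2 [V1 [V2 [cu [cV [eq [i0 [i1 [j0 j1]]]]]]]]]] [nn lim]]]]].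
exists u, u1, V, V1; split; [|split; [|repeat split; easy]].
- apply (radial_of_C2_on d u u1 u2); try easy; intros; now apply eq.
- apply (radial_of_C2_on d V V1 V2); try easy; intros; now apply eq.
Qed.

Lemma potential_nondecreasing (d : R) (V V1 g : R -> R) (s r : R) :
  radial d V V1 (fun r => g r ^ 2) -> 0 <= s <= r -> V s <= V r.
Proof.
intros h sr; apply (radial_nondecreasing d V V1 _ r s r h sr); [lra|].
intros; apply pow2_ge_0.
Qed.

(** [V - 1] changes sign at most once, so the flux of [u] decreases, then increases. *)
Lemma flux_stays_positive (d : R) (u u1 V V1 g : R -> R) (s r : R) :
  radial d u u1 (fun r => (V r - 1) * g r) -> radial d V V1 (fun r => g r ^ 2) ->
  (forall t, 0 < t -> 0 <= g t) -> 0 < s <= r -> 0 < u1 s -> 0 < u1 r.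
Proof.
intros hu hV g0 sr u1s.
assert (Vs : 1 < V s).
{ apply Rnot_le_lt; intros Vs.
  pose proof (radial_lincomb d (-1) 0 _ _ _ _ _ _ hu hu) as h.
  assert (H := radial_derive_nonneg d _ _ _ s h ltac:(lra)).
  simpl in H; enough (0 <= -1 * u1 s + 0 * u1 s) by lra.
  apply H; intros t ht; specialize (g0 t ltac:(lra)).
  pose proof (potential_nondecreasing d V V1 g t s hV ltac:(lra)); nra. }
apply (flux_pos d); apply (flux_pos d) in u1s.
apply Rlt_le_trans with (1 := u1s).
apply (radial_flux_mono d u u1 _ s r hu sr).
intros t ht; specialize (g0 t ltac:(lra)).
pose proof (potential_nondecreasing d V V1 g s t hV ltac:(lra)); nra.
Qed.

Lemma is_lim_0_eventually_lt (u : R -> R) (eps : R) : is_lim u p_infty 0 -> 0 < eps ->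
  exists R0, 0 < R0 /\ forall r, R0 <= r -> u r < eps.
Proof.
intros lim e0.
apply is_lim_spec in lim; destruct (lim (mkposreal eps e0)) as [M hM].
exists (Rmax 1 (M + 1)); split; [apply Rlt_le_trans with 1; [lra|apply Rmax_l]|].
intros r hr; pose proof (Rmax_r 1 (M + 1)).
specialize (hM r ltac:(lra)); simpl in hM; apply Rabs_def2 in hM; lra.
Qed.

(** Once positive, the derivative stays positive, so [u >= 0] would increase from then on and could
    not tend to [0]. *)
Lemma ground_state_derive_nonpos (d u0 : R) (u u1 V V1 : R -> R) (r : R) :
  ground_state d u0 u u1 V V1 -> 0 < r -> u1 r <= 0.
Proof.
intros [hu [hV [_ [_ [_ [nn lim]]]]]] r0.
apply Rnot_lt_le; intros pos.
assert (mono : forall s t, r <= s -> s < t -> u s < u t).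
{ intros s t rs st; apply (increasing_of_derive u u1); [easy| |].
  - intros x hx; apply hu; lra.
  - intros x hx; apply (flux_stays_positive d u u1 V V1 u r); try easy; [|lra].
    intros; apply nn; lra. }
assert (p : 0 < u (r + 1)).
{ apply Rle_lt_trans with (u r); [apply nn; lra|apply mono; lra]. }
destruct (is_lim_0_eventually_lt u _ lim p) as [R0 [R0p hR]].
specialize (hR (R0 + r + 2) ltac:(lra)).
pose proof (mono (r + 1) (R0 + r + 2)); lra.
Qed.

(* If [u0 < 1] then [V - 1 <= -(1 - u0)], and [u] oscillates: [z = -u/u'] satisfies the
   Riccati inequality [z' <= -1 + (d-1) z / r], with [z = O(1/r)], and becomes negative. *)
Lemma ground_state_ge_1 (d u0 : R) (u u1 V V1 : R -> R) : 0 < d ->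
  ground_state d u0 u u1 V V1 -> 1 <= u0.
Proof.
intros d0 gs; pose proof gs as [hu [hV [i0 [j0 [u0p [nn lim]]]]]].
apply Rnot_lt_le; intros u0lt.
pose (c := 1 - u0).
(* The function [1 - u - V] has Laplacian [u (1 - u - V)] and starts at [c > 0], so it stays at
   least [c]. *)
assert (Vle : forall r, 0 <= r -> V r - 1 <= - c).
{ intros r r0.
  pose proof (radial_lincomb d (-1) 1 _ _ _ _ _ _
    (radial_lincomb d 1 1 _ _ _ _ _ _ hu hV) (radial_const d 1 d0)) as h.
  assert (H := radial_sign_preserved d _ _ _ h); simpl in H.
  rewrite i0, j0 in H.
  specialize (H ltac:(lra)).
  assert (K : -1 * (1 * u0 + 1 * 0) + 1 * 1 <= -1 * (1 * u r + 1 * V r) + 1 * 1).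
  { apply H; [|easy]; intros t t0 k; specialize (nn t ltac:(lra)); nra. }
  specialize (nn r r0); unfold c; lra. }
pose proof (radial_lincomb d (-1) 0 _ _ _ _ _ _ hu hu) as hmu.
(* At a first zero the flux of [-u] is positive; it is nondecreasing since [V < 1] and [u >= 0], so
   [u] would become negative just after. *)
assert (upos : forall r, 0 <= r -> 0 < u r).
{ intros r r0; apply Rnot_le_lt; intros ur.
  destruct (first_zero u r) as [b [b0 [ub below]]]; try easy.
  - intros t t0; now apply (radial_continuity_pt d u u1 _ t hu).
  - apply hu.
  - lra.
  - assert (p : 0 < -1 * u1 b + 0 * u1 b).
    { apply (radial_derive_pos d _ _ _ b hmu); [lra|].
      intros t ht; specialize (Vle t ltac:(lra)); specialize (below t ltac:(lra)).
      unfold c in *; nra. }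
    assert (- u b < - u (b + 1)); [|specialize (nn (b + 1) ltac:(lra)); lra].
    apply (increasing_of_derive (fun r => - u r) (fun r => - u1 r)); [lra| |].
    + intros x hx; apply (is_derive_opp u); apply hu; lra.
    + intros x hx; enough (0 < -1 * u1 x + 0 * u1 x) by lra.
      apply (flux_pos d (fun r => -1 * u1 r + 0 * u1 r) x).
      apply (flux_pos d (fun r => -1 * u1 r + 0 * u1 r) b) in p.
      apply Rlt_le_trans with (1 := p).
      apply (radial_flux_mono d _ _ _ b x hmu); [lra|].
      intros t ht; specialize (Vle t ltac:(lra)); specialize (nn t ltac:(lra)).
      unfold c in *; nra. }
assert (u1neg : forall r, 0 < r -> u1 r < 0).
{ intros r r0; enough (0 < -1 * u1 r + 0 * u1 r) by lra.
  apply (radial_derive_pos d _ _ _ r hmu); [lra|].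
  intros t ht; specialize (Vle t ltac:(lra)); specialize (upos t ltac:(lra)).
  unfold c in *; nra. }
(* For fixed [r], the Laplacian of [-u] on []0, r[] is at least [c u(r)], because [u] decreases; the
   barrier [c u(r) t^2 / (2 d)] then bounds [-u1 r] from below. This is [z <= d / (c r)] for the [z]
   that follows. *)
assert (slope : forall r, 0 < r -> c * r * u r <= d * - u1 r).
{ intros r r0.
  pose proof (radial_lincomb d 1 (- (c * u r / (2 * d))) _ _ _ _ _ _
    hmu (radial_sq d d0)) as h.
  assert (H := radial_derive_nonneg d _ _ _ r h r0); simpl in H.
  assert (K : 0 <= 1 * (-1 * u1 r + 0 * u1 r) + - (c * u r / (2 * d)) * (2 * r)).
  { apply H; intros t ht.
    replace (- (c * u r / (2 * d)) * (2 * d)) with (- (c * u r)) by (field; lra).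
    assert (u r <= u t).
    { apply Ropp_le_cancel.
      apply (nondecreasing_of_derive (fun r => - u r) (fun r => - u1 r)); [lra| |].
      - intros x hx; apply (is_derive_opp u); apply hu; lra.
      - intros x hx; specialize (u1neg x ltac:(lra)); lra. }
    specialize (Vle t ltac:(lra)); specialize (upos t ltac:(lra)); unfold c in *; nra. }
  apply Rmult_le_compat_l with (r := d) in K; [|lra].
  replace (d * (1 * (-1 * u1 r + 0 * u1 r) + - (c * u r / (2 * d)) * (2 * r)))
    with (d * - u1 r - c * r * u r) in K by (field; lra); lra. }
(* Numerator and denominator of [-u/u'] carry the factor [r^(d-1)] because [radial] differentiates
   the flux rather than [u1]. *)
pose (z := fun r => - (u r * Rpower r (d - 1)) / flux d u1 r).
assert (zE : forall r, 0 < r -> z r = - u r / u1 r).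
{ intros r r0; unfold z, flux; pose proof (Rpower_pos r (d - 1)).
  specialize (u1neg r r0); field; lra. }
assert (zpos : forall r, 0 < r -> 0 < z r).
{ intros r r0; rewrite zE by easy; specialize (u1neg r r0).
  specialize (upos r ltac:(lra)).
  replace (- u r / u1 r) with (u r / - u1 r) by (field; lra).
  apply Rdiv_lt_0_compat; lra. }
assert (zle : forall r, 0 < r -> c * r * z r <= d).
{ intros r r0; rewrite zE by easy; specialize (u1neg r r0); specialize (slope r r0).
  apply Rmult_le_reg_r with (- u1 r); [lra|].
  replace (c * r * (- u r / u1 r) * - u1 r) with (c * r * u r) by (field; lra); lra. }
pose (z' := fun r => - 1 + (d - 1) / r * z r + (V r - 1) * z r ^ 2).
assert (dz : forall r, 0 < r -> is_derive z r (z' r)).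
{ intros r r0; pose proof (Rpower_pos r (d - 1)) as wp.
  assert (fn : flux d u1 r <> 0) by (unfold flux; specialize (u1neg r r0); nra).
  eapply is_derive_eq.
  { apply (is_derive_div (fun r => - (u r * Rpower r (d - 1))) (flux d u1)).
    - apply (is_derive_opp (fun r => u r * Rpower r (d - 1))).
      apply (is_derive_mult u (fun r => Rpower r (d - 1))).
      + now apply hu.
      + now apply is_derive_Rpower.
      + intros; apply Rmult_comm.
    - now apply hu.
    - easy. }
  unfold z', z; rewrite (Rpower_succ (d - 1) r r0) in *; revert fn; unfold flux.
  rewrite (Rpower_succ (d - 1) r r0).
  unfold opp, plus, mult; simpl; intros fn; field.
  specialize (u1neg r r0); pose proof (Rpower_pos r (d - 1 - 1)).
  repeat split; lra. }
assert (c0 : 0 < c) by (unfold c; lra).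
(* For [r >= R0] both [r >= 1] and [c r >= 2 d^2] hold, so that
   [(d-1) z / r <= d^2 / (c r^2) <= 1/2]. *)
pose (R0 := 1 + 2 * d ^ 2 / c).
assert (R0p : 1 < R0).
{ assert (0 < 2 * d ^ 2 / c) by (apply Rdiv_lt_0_compat; nra); unfold R0; lra. }
assert (dec : forall r, R0 <= r -> z' r <= - / 2).
{ intros r rR; unfold z'.
  specialize (zpos r ltac:(lra)); specialize (zle r ltac:(lra)).
  specialize (Vle r ltac:(lra)).
  assert (a : (V r - 1) * z r ^ 2 <= 0) by (pose proof (pow2_ge_0 (z r)); nra).
  assert (b : (d - 1) / r * z r <= / 2); [|lra].
  assert (e : 2 * d ^ 2 <= c * r).
  { replace (2 * d ^ 2) with (c * (R0 - 1)) by (unfold R0; field; lra); nra. }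
  apply Rmult_le_reg_r with (c * r * r); [nra|].
  replace ((d - 1) / r * z r * (c * r * r)) with ((d - 1) * (c * r * z r)) by (field; lra).
  assert (0 <= c * r * z r) by (apply Rmult_le_pos; nra).
  apply Rle_trans with (d * d); [nra|].
  assert (0 <= c * r) by nra.
  assert (c * r <= c * r * r) by nra; lra. }
(* With slope at most [-1/2] from [R0] on, [z] is nonpositive at this point. *)
pose (r := R0 + 2 * z R0).
pose proof (zpos R0 ltac:(lra)) as zR.
assert (H : - z R0 - / 2 * R0 <= - z r - / 2 * r).
{ apply (nondecreasing_of_derive (fun r => - z r - / 2 * r) (fun r => - z' r - / 2)).
  - unfold r; lra.
  - intros x hx; apply (is_derive_minus (fun r => - z r) (fun r => / 2 * r)).
    + apply (is_derive_opp z), dz; lra.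
    + auto_derive; [easy|ring].
  - intros x hx; specialize (dec x ltac:(lra)); lra. }
specialize (zpos r ltac:(unfold r; lra)); unfold r in H at 2; lra.
Qed.

(** * Comparison of two ground states through their Wronskian *)

Lemma derive_nonpos_at_first_zero (f : R -> R) (c l : R) :
  0 < c -> is_derive f c l -> f c = 0 -> (forall r, 0 <= r < c -> 0 < f r) -> l <= 0.
Proof.
intros c0 df fc pos; apply Rnot_lt_le; intros l0.
apply is_derive_Reals in df; destruct (df l l0) as [dl h].
pose (x := - Rmin (dl / 2) (c / 2)).
assert (hx : - dl < x < 0 /\ - c < x).
{ pose proof (cond_pos dl); unfold x.
  pose proof (Rmin_l (dl / 2) (c / 2)); pose proof (Rmin_r (dl / 2) (c / 2)).
  assert (0 < Rmin (dl / 2) (c / 2)) by (apply Rmin_glb_lt; lra); lra. }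
specialize (h x ltac:(lra) ltac:(apply Rabs_def1; lra)).
specialize (pos (c + x) ltac:(lra)); rewrite fc in h.
apply Rabs_def2 in h.
assert ((f (c + x) - 0) / x < 0); [|lra].
replace ((f (c + x) - 0) / x) with (- (f (c + x) / - x)) by (field; lra).
apply Ropp_lt_gt_0_contravar, Rdiv_lt_0_compat; lra.
Qed.

(** The weight [r^(d-1)] inside the fluxes removes the first-order terms from the derivative, and
    the products of [u1] and [v1] cancel. *)
Definition wronskian (d : R) (u u1 v v1 : R -> R) (r : R) : R :=
  flux d v1 r * u r - flux d u1 r * v r.

Lemma is_derive_wronskian (d : R) (u u1 v v1 P Q : R -> R) (r : R) :
  radial d u u1 (fun r => (P r - 1) * u r) ->
  radial d v v1 (fun r => (Q r - 1) * v r) -> 0 < r ->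
  is_derive (wronskian d u u1 v v1) r (Rpower r (d - 1) * ((Q r - P r) * u r * v r)).
Proof.
intros hu hv r0; eapply is_derive_eq.
{ apply (is_derive_minus (fun r => flux d v1 r * u r) (fun r => flux d u1 r * v r)).
  - apply (is_derive_mult (flux d v1) u); [now apply hv|now apply hu|].
    intros; apply Rmult_comm.
  - apply (is_derive_mult (flux d u1) v); [now apply hu|now apply hv|].
    intros; apply Rmult_comm. }
unfold minus, opp, plus, mult, flux; simpl; ring.
Qed.

Lemma wronskian_at_right_0 (d : R) (u u1 F v v1 H : R -> R) :
  radial d u u1 F -> radial d v v1 H ->
  filterlim (wronskian d u u1 v v1) (at_right 0) (locally 0).
Proof.
intros [_ [_ [u_3 u_4]]] [_ [_ [v_3 v_4]]].
apply filterlim_ext with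
  (fun r => 1 * (flux d v1 r * u r) + -1 * (flux d u1 r * v r)).
{ intros r; unfold wronskian; ring_R. }
replace 0 with (1 * (0 * u 0) + -1 * (0 * v 0)) at 2 by ring.
apply at_right_0_lincomb.
- eapply filterlim_comp_2; [exact v_4|exact u_3|apply (filterlim_mult 0 (u 0))].
- eapply filterlim_comp_2; [exact u_4|exact v_3|apply (filterlim_mult 0 (v 0))].
Qed.

Lemma wronskian_pos (d u0 v0 b : R) (u u1 P P1 v v1 Q Q1 : R -> R) :
  ground_state d u0 u u1 P P1 -> ground_state d v0 v v1 Q Q1 -> 0 < b ->
  (forall t, 0 < t < b -> u t < v t) ->
  0 < wronskian d u u1 v v1 b /\
  forall s, 0 < s <= b -> wronskian d u u1 v v1 s <= wronskian d u u1 v v1 b.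
Proof.
intros [hu [hP [i0 [P0 [u0p [unn _]]]]]] [hv [hQ [j0 [Q0 [v0p [vnn _]]]]]] b0 lt.
assert (PQ : forall t, 0 < t < b -> P t < Q t).
{ intros t ht.
  pose proof (radial_lincomb d 1 (-1) _ _ _ _ _ _ hQ hP) as h.
  enough (1 * Q 0 + -1 * P 0 < 1 * Q t + -1 * P t) by lra.
  apply (increasing_on_half_line (fun t => 1 * Q t + -1 * P t)
    (fun t => 1 * Q1 t + -1 * P1 t)); [apply h|apply h|lra|].
  intros s hs; apply (radial_derive_pos d _ _ _ s h); [lra|].
  intros x hx; specialize (lt x ltac:(lra)); specialize (unn x ltac:(lra)); nra. }
assert (mono : forall s, 0 < s <= b ->
  wronskian d u u1 v v1 s <= wronskian d u u1 v v1 b).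
{ intros s hs; eapply (nondecreasing_of_derive (wronskian d u u1 v v1)); [lra| |].
  - intros x hx; apply (is_derive_wronskian d u u1 v v1 P Q); try easy; lra.
  - intros x hx; apply Rmult_le_pos; [apply Rlt_le, Rpower_pos|].
    specialize (PQ x ltac:(lra)); specialize (unn x ltac:(lra)).
    specialize (vnn x ltac:(lra)); apply Rmult_le_pos; nra. }
split; [|easy].
(* Strictness comes from a neighbourhood of [0], where [u] is close to [u0 > 0]; farther out only
   [u >= 0] is known. *)
destruct (proj1 (at_right_0_spec u (u 0)) ltac:(apply hu) u0 u0p) as [dl [dl0 hd]].
pose (s := Rmin (dl / 2) (b / 2)).
assert (hs : 0 < s < dl /\ s < b).
{ unfold s; pose proof (Rmin_l (dl / 2) (b / 2)); pose proof (Rmin_r (dl / 2) (b / 2)).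
  assert (0 < Rmin (dl / 2) (b / 2)) by (apply Rmin_glb_lt; lra); lra. }
apply Rlt_le_trans with (2 := mono s ltac:(lra)).
eapply (gt_limit_of_derive (wronskian d u u1 v v1)); [lra| | |].
- intros x hx; apply (is_derive_wronskian d u u1 v v1 P Q); try easy; lra.
- eapply wronskian_at_right_0; [exact hu|exact hv].
- intros x hx; apply Rmult_lt_0_compat; [apply Rpower_pos|].
  specialize (PQ x ltac:(lra)); specialize (lt x ltac:(lra)).
  specialize (hd x ltac:(lra)); rewrite i0 in hd; apply Rabs_def2 in hd.
  apply Rmult_lt_0_compat; [apply Rmult_lt_0_compat|]; lra.
Qed.

(* At a first crossing [c] the Wronskian would be [c^(d-1) u(c) (v - u)'(c) <= 0]. *)
Lemma ground_states_ordered (d u0 v0 : R) (u u1 P P1 v v1 Q Q1 : R -> R) :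
  ground_state d u0 u u1 P P1 -> ground_state d v0 v v1 Q Q1 -> u0 < v0 ->
  forall r, 0 <= r -> u r < v r.
Proof.
intros gu gv lt r r0; apply Rnot_le_lt; intros le.
pose proof gu as [hu [_ [i0 [_ [_ [unn _]]]]]].
pose proof gv as [hv [_ [j0 _]]].
pose proof (radial_lincomb d 1 (-1) _ _ _ _ _ _ hv hu) as h.
destruct (first_zero (fun r => 1 * v r + -1 * u r) r) as [c [c0 [fc below]]].
- intros t t0; apply (radial_continuity_pt d _ _ _ t h t0).
- apply h.
- lra.
- easy.
- lra.
- destruct (wronskian_pos d u0 v0 c u u1 P P1 v v1 Q Q1 gu gv) as [W _].
  + lra.
  + intros t ht; specialize (below t ltac:(lra)); lra.
  + assert (s : 1 * v1 c + -1 * u1 c <= 0).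
    { apply (derive_nonpos_at_first_zero (fun r => 1 * v r + -1 * u r) c); try easy.
      apply h; lra. }
    unfold wronskian, flux in W; replace (v c) with (u c) in W by lra.
    specialize (unn c ltac:(lra)); pose proof (Rpower_pos c (d - 1)) as wp.
    assert (0 <= Rpower c (d - 1) * u c) by (apply Rmult_le_pos; lra); nra.
Qed.

Lemma ground_state_unique (d u0 v0 : R) (u u1 P P1 v v1 Q Q1 : R -> R) : 0 < d ->
  ground_state d u0 u u1 P P1 -> ground_state d v0 v v1 Q Q1 -> u0 < v0 -> False.
Proof.
intros d0 gu gv lt.
pose proof (ground_state_ge_1 d u0 u u1 P P1 d0 gu) as u0ge.
pose proof (ground_states_ordered d u0 v0 u u1 P P1 v v1 Q Q1 gu gv lt) as ord.
pose proof gu as [hu [hP [i0 [P0 [_ [unn _]]]]]].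
pose proof gv as [hv [hQ [j0 [Q0 [_ [vnn lim]]]]]].
pose (c := (v0 - 1) / 2).
(* The function [v + Q - 1] has Laplacian [v (v + Q - 1)] and starts at [v0 - 1 = 2 c], which is
   positive because [v0 > u0 >= 1]. Once [v < c], this gives [Q - 1 >= c]. *)
assert (hge : forall r, 0 <= r -> v0 - 1 <= v r + Q r - 1).
{ intros r r0.
  pose proof (radial_lincomb d 1 (-1) _ _ _ _ _ _
    (radial_lincomb d 1 1 _ _ _ _ _ _ hv hQ) (radial_const d 1 d0)) as h.
  assert (H := radial_sign_preserved d _ _ _ h); simpl in H.
  rewrite j0, Q0 in H; specialize (H ltac:(lra)).
  enough (1 * (1 * v0 + 1 * 0) + -1 * 1 <= 1 * (1 * v r + 1 * Q r) + -1 * 1) by lra.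
  apply H; [|easy]; intros t t0 k; specialize (vnn t ltac:(lra)); nra. }
destruct (is_lim_0_eventually_lt v c lim ltac:(unfold c; lra)) as [R0 [R0p hR]].
pose (C := Rabs (flux d u1 R0 + / c * flux d v1 R0)).
assert (c0 : 0 < c) by (unfold c; lra).
assert (flux_ge : forall r, R0 <= r -> - C <= flux d u1 r).
{ intros r rR.
  pose proof (radial_lincomb d 1 (/ c) _ _ _ _ _ _ hu hv) as h.
  assert (H := radial_flux_mono d _ _ _ R0 r h ltac:(lra)); simpl in H.
  assert (K : flux d (fun r => 1 * u1 r + / c * v1 r) R0 <=
    flux d (fun r => 1 * u1 r + / c * v1 r) r).
  { apply H; intros t ht.
    pose proof (potential_nondecreasing d P P1 u 0 t hP ltac:(lra)) as Pt.
    specialize (hge t ltac:(lra)); specialize (hR t ltac:(lra)).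
    specialize (ord t ltac:(lra)); specialize (unn t ltac:(lra)).
    assert (1 <= / c * (Q t - 1)).
    { apply Rmult_le_reg_l with c; [easy|].
      rewrite <- Rmult_assoc, Rinv_r; unfold c in *; lra. }
    nra. }
  unfold flux in K.
  assert (flux d v1 r <= 0).
  { pose proof (ground_state_derive_nonpos d v0 v v1 Q Q1 r gv ltac:(lra)).
    unfold flux; pose proof (Rpower_pos r (d - 1)); nra. }
  assert (/ c * flux d v1 r <= 0) by (pose proof (Rinv_0_lt_compat c c0); nra).
  pose proof (Rle_abs (- (flux d u1 R0 + / c * flux d v1 R0))) as A.
  rewrite Rabs_Ropp in A; fold C in A; unfold flux in *; lra. }
destruct (wronskian_pos d u0 v0 R0 u u1 P P1 v v1 Q Q1 gu gv R0p) as [W _].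
{ intros t ht; apply ord; lra. }
assert (Cp : 0 <= C) by apply Rabs_pos.
(* Where [v < eps], the Wronskian is at most [C v <= C eps], which is less than [(C + 1) eps], its
   value at [R0]; the Wronskian is nondecreasing. *)
pose (eps := wronskian d u u1 v v1 R0 / (C + 1)).
destruct (is_lim_0_eventually_lt v eps lim) as [R1 [R1p hR1]].
{ apply Rdiv_lt_0_compat; lra. }
pose (r := R0 + R1).
specialize (hR1 r ltac:(unfold r; lra)); specialize (flux_ge r ltac:(unfold r; lra)).
destruct (wronskian_pos d u0 v0 r u u1 P P1 v v1 Q Q1 gu gv) as [_ M].
{ unfold r; lra. }
{ intros t ht; apply ord; lra. }
specialize (M R0 ltac:(unfold r; lra)).
pose proof (ground_state_derive_nonpos d v0 v v1 Q Q1 r gv ltac:(unfold r; lra)) as v1r.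
assert (flux d v1 r * u r <= 0).
{ specialize (unn r ltac:(unfold r; lra)); pose proof (Rpower_pos r (d - 1)).
  assert (flux d v1 r <= 0) by (unfold flux; nra); nra. }
specialize (vnn r ltac:(unfold r; lra)).
assert (wronskian d u u1 v v1 r <= C * v r) by (unfold wronskian; nra).
assert (E : (C + 1) * eps = wronskian d u u1 v v1 R0) by (unfold eps; field; lra).
nra.
Qed.

(** * The radial Newton potential *)

(** [Rpower 0 y] is [1] by convention, so the value [0] for [x <= 0] is set by hand; [root d] is
    then continuous on the whole line, and so is [f (root d x)]. *)
Definition root (d x : R) : R := if Rle_dec x 0 then 0 else Rpower x (/ d).

(** The substitution [x = t^d] makes
    [avg d f s = s^(-d) * int_0^s f(t) t^(d-1) dt] a proper integral, so
    that [s * avg d f s] is the radial derivative of the solution of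
    [w'' + (d-1)/r w' = f]. *)
Definition avg (d : R) (f : R -> R) (s : R) : R :=
  if Rle_dec s 0 then f 0 / d
  else RInt (fun x => f (root d x)) 0 (Rpower s d) / (d * Rpower s d).

Definition newton (d : R) (f : R -> R) (r : R) : R := RInt (fun s => s * avg d f s) 0 r.

Lemma root_continuous (d x : R) : 0 < d -> continuous (root d) x.
Proof.
intros d0; assert (i0 : 0 < / d) by now apply Rinv_0_lt_compat.
destruct (Rtotal_order x 0) as [neg | [-> | pos]].
- apply continuous_ext_loc with (fun _ => 0); [|apply continuous_const].
  apply (locally_interval _ x m_infty 0); try easy.
  intros y _ y0; simpl in y0; unfold root; destruct (Rle_dec y 0); [easy|lra].
- apply continuity_pt_filterlim; intros eps e0.
  destruct (Rpower_small (/ d) eps i0 e0) as [dl [dl0 h]].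
  exists dl; split; [easy|]; intros y [_ hy]; simpl in *; unfold R_dist in *.
  unfold root at 2; destruct (Rle_dec 0 0); [|lra].
  unfold root; destruct (Rle_dec y 0); rewrite Rminus_0_r.
  + now rewrite Rabs_R0.
  + apply Rabs_def2 in hy; rewrite Rabs_right; [apply h; lra|].
    apply Rle_ge, Rlt_le, Rpower_pos.
- apply continuous_ext_loc with (fun y => Rpower y (/ d)).
  + apply (locally_interval _ x 0 p_infty); try easy.
    intros y y0 _; simpl in y0; unfold root; destruct (Rle_dec y 0); [lra|easy].
  + apply (ex_derive_continuous (fun y => Rpower y (/ d))).
    eexists; now apply is_derive_Rpower.
Qed.

Lemma root_bounds (d s x : R) : 0 < d -> 0 < s -> 0 <= x <= Rpower s d ->
  0 <= root d x <= s.
Proof.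
intros d0 s0 hx; unfold root; destruct (Rle_dec x 0); [lra|].
split; [apply Rlt_le, Rpower_pos|].
replace s with (Rpower (Rpower s d) (/ d)).
- apply Rle_Rpower_l; [|lra]; apply Rlt_le; now apply Rinv_0_lt_compat.
- rewrite Rpower_mult, Rinv_r, Rpower_1; lra.
Qed.

Lemma root_Rpower (d s : R) : 0 < d -> 0 < s -> root d (Rpower s d) = s.
Proof.
intros d0 s0; unfold root; pose proof (Rpower_pos s d).
destruct (Rle_dec (Rpower s d) 0); [lra|].
rewrite Rpower_mult, Rinv_r, Rpower_1; lra.
Qed.

Lemma continuous_comp_root (d : R) (f : R -> R) (x : R) : 0 < d ->
  (forall t, continuous f t) -> continuous (fun x => f (root d x)) x.
Proof. intros d0 cf; apply continuous_comp; [now apply root_continuous|apply cf]. Qed.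

Lemma ex_RInt_root (d : R) (f : R -> R) (a b : R) : 0 < d ->
  (forall t, continuous f t) -> ex_RInt (fun x => f (root d x)) a b.
Proof.
intros d0 cf; apply (ex_RInt_continuous (fun x => f (root d x))).
intros; now apply continuous_comp_root.
Qed.

Lemma avg_diff_bound (d b s : R) (f g : R -> R) : 0 < d -> 0 <= s ->
  (forall t, continuous f t) -> (forall t, continuous g t) ->
  (forall t, 0 <= t <= s -> Rabs (f t - g t) <= b) ->
  Rabs (avg d f s - avg d g s) <= b / d.
Proof.
intros d0 s0 cf cg bd; unfold avg; destruct (Rle_dec s 0) as [sle | sgt].
- replace (f 0 / d - g 0 / d) with ((f 0 - g 0) / d) by (field; lra).
  unfold Rdiv; rewrite Rabs_mult, (Rabs_right (/ d)).
  + apply Rmult_le_compat_r; [apply Rlt_le; now apply Rinv_0_lt_compat|].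
    apply bd; lra.
  + apply Rle_ge, Rlt_le; now apply Rinv_0_lt_compat.
- pose proof (Rpower_pos s d) as pp.
  set (p := Rpower s d) in *.
  assert (e : RInt (fun x => f (root d x)) 0 p - RInt (fun x => g (root d x)) 0 p =
    RInt (fun x => f (root d x) - g (root d x)) 0 p).
  { symmetry; apply (RInt_minus (fun x => f (root d x)) (fun x => g (root d x)));
      now apply ex_RInt_root. }
  replace (RInt (fun x => f (root d x)) 0 p / (d * p) -
    RInt (fun x => g (root d x)) 0 p / (d * p))
    with (RInt (fun x => f (root d x) - g (root d x)) 0 p / (d * p))
    by (rewrite <- e; field; lra).
  assert (h : Rabs (RInt (fun x => f (root d x) - g (root d x)) 0 p) <= (p - 0) * b).
  { apply abs_RInt_le_const; [lra| |].
    - apply (ex_RInt_minus (fun x => f (root d x)) (fun x => g (root d x)));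
        now apply ex_RInt_root.
    - intros t ht; apply bd; apply root_bounds; [easy|lra|easy]. }
  unfold Rdiv; rewrite Rabs_mult, (Rabs_right (/ (d * p))).
  + replace (b * / d) with ((p - 0) * b * / (d * p)) by (field; lra).
    apply Rmult_le_compat_r; [|easy].
    apply Rlt_le, Rinv_0_lt_compat; nra.
  + apply Rle_ge, Rlt_le, Rinv_0_lt_compat; nra.
Qed.

Lemma avg_const (d c s : R) : 0 < d -> avg d (fun _ => c) s = c / d.
Proof.
intros d0; unfold avg; destruct (Rle_dec s 0); [easy|].
rewrite RInt_const; unfold scal; simpl; unfold mult; simpl.
pose proof (Rpower_pos s d); field; lra.
Qed.

Lemma avg_0 (d : R) (f : R -> R) : avg d f 0 = f 0 / d.
Proof. unfold avg; destruct (Rle_dec 0 0); [easy|lra]. Qed.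

Lemma is_derive_RInt_root (d : R) (f : R -> R) (y : R) : 0 < d ->
  (forall t, continuous f t) ->
  is_derive (RInt (fun x => f (root d x)) 0) y (f (root d y)).
Proof.
intros d0 cf; apply (is_derive_RInt (fun x => f (root d x)) _ 0).
- apply filter_forall; intros b.
  apply (RInt_correct (fun x => f (root d x))); now apply ex_RInt_root.
- now apply continuous_comp_root.
Qed.

Lemma is_derive_mul_avg (d : R) (f : R -> R) (r : R) : 0 < d ->
  (forall t, continuous f t) -> 0 < r ->
  is_derive (fun s => s * avg d f s) r (f r - (d - 1) * avg d f r).
Proof.
intros d0 cf r0.
(* For [s > 0], [s * avg d f s] is the integral up to [s^d] times [s^(1-d) / d], to which the
   product and chain rules apply. *)
apply is_derive_ext_loc with
  (fun s => RInt (fun x => f (root d x)) 0 (Rpower s d) * (/ d * Rpower s (1 - d))).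
{ apply (locally_interval _ r 0 p_infty); try easy.
  intros s s0 _; simpl in s0; unfold avg; destruct (Rle_dec s 0); [lra|].
  replace (Rpower s (1 - d)) with (s * / Rpower s d).
  - pose proof (Rpower_pos s d).
    field_R; lra.
  - rewrite <- Rpower_Ropp; rewrite <- (Rpower_1 s) at 1 by easy.
    rewrite <- Rpower_plus; f_equal; ring. }
eapply is_derive_eq.
{ apply (is_derive_mult (fun s => RInt (fun x => f (root d x)) 0 (Rpower s d))
    (fun s => / d * Rpower s (1 - d))).
  - apply (is_derive_comp (RInt (fun x => f (root d x)) 0) (fun s => Rpower s d)).
    + now apply is_derive_RInt_root.
    + now apply is_derive_Rpower.
  - apply is_derive_scal, is_derive_Rpower; easy.
  - intros; apply Rmult_comm. }
rewrite root_Rpower by easy.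
unfold avg; destruct (Rle_dec r 0); [lra|].
unfold plus, mult, scal; simpl; unfold mult; simpl.
replace (1 - d - 1) with (- d) by ring; rewrite Rpower_Ropp.
replace (Rpower r (1 - d)) with (/ Rpower r (d - 1)).
2: { rewrite <- Rpower_Ropp; f_equal; ring. }
pose proof (Rpower_pos r d); pose proof (Rpower_pos r (d - 1)).
field; lra.
Qed.

Lemma avg_continuous (d : R) (f : R -> R) (s : R) : 0 < d ->
  (forall t, continuous f t) -> continuous (avg d f) s.
Proof.
intros d0 cf; destruct (Rtotal_order s 0) as [neg | [-> | pos]].
- apply continuous_ext_loc with (fun _ => f 0 / d); [|apply continuous_const].
  apply (locally_interval _ s m_infty 0); try easy.
  intros y _ y0; simpl in y0; unfold avg; destruct (Rle_dec y 0); [easy|lra].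
- apply continuity_pt_filterlim; intros eps e0.
  destruct (proj2 (continuity_pt_filterlim f 0) (cf 0) (d * (eps / 2)) ltac:(nra))
    as [dl [dl0 h]].
  exists dl; split; [easy|]; intros y [_ hy]; simpl in *; unfold R_dist in *.
  rewrite avg_0; apply Rabs_def2 in hy.
  destruct (Rle_or_lt y 0) as [yle | yp].
  { unfold avg; destruct (Rle_dec y 0); [|lra].
    rewrite Rminus_diag, Rabs_R0; easy. }
  (* The value at [0] is the average of the constant [f 0], so continuity there is a bound on a
     difference of averages. *)
  rewrite <- (avg_const d (f 0) y d0).
  apply Rle_lt_trans with (d * (eps / 2) / d).
  + apply avg_diff_bound; try easy; [lra|intros; apply continuous_const|].
    intros t ht; destruct (Req_dec t 0) as [-> | ne].
    * rewrite Rminus_diag, Rabs_R0; nra.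
    * apply Rlt_le, h; split; [split; [exact I|lra]|].
      rewrite Rminus_0_r, Rabs_right; lra.
  + replace (d * (eps / 2) / d) with (eps / 2) by (field; lra); lra.
- apply continuous_ext_loc with (fun s => s * avg d f s * / s).
  + apply (locally_interval _ s 0 p_infty); try easy.
    intros y y0 _; simpl in y0.
    field_R; lra.
  + apply (continuous_mult (fun s => s * avg d f s) Rinv).
    * apply (ex_derive_continuous (fun s => s * avg d f s)); eexists.
      now apply is_derive_mul_avg.
    * apply (ex_derive_continuous Rinv); auto_derive; lra.
Qed.

Lemma is_derive_newton (d : R) (f : R -> R) (r : R) : 0 < d ->
  (forall t, continuous f t) -> is_derive (newton d f) r (r * avg d f r).
Proof.
intros d0 cf.
assert (c : forall s, continuous (fun s => s * avg d f s) s).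
{ intros s; apply (continuous_mult (fun s => s) (avg d f));
    [apply continuous_id|now apply avg_continuous]. }
apply (is_derive_RInt (fun s => s * avg d f s) _ 0); [|apply c].
apply filter_forall; intros b.
apply (RInt_correct (fun s => s * avg d f s)), (ex_RInt_continuous (fun s => s * avg d f s)).
intros; apply c.
Qed.

Lemma newton_continuous (d : R) (f : R -> R) (r : R) : 0 < d ->
  (forall t, continuous f t) -> continuous (newton d f) r.
Proof.
intros d0 cf; apply (ex_derive_continuous (newton d f)).
eexists; now apply is_derive_newton.
Qed.

Lemma newton_0 (d : R) (f : R -> R) : newton d f 0 = 0.
Proof. apply (RInt_point 0 (fun s => s * avg d f s)). Qed.

Lemma D_in_of_is_derive (f : R -> R) (f1 : R -> R) (D : R -> Prop) (r : R) :
  is_derive f r (f1 r) -> D_in f f1 D r.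
Proof.
intros h eps e0; apply is_derive_Reals in h.
destruct (h eps e0) as [dl hd]; exists dl; split; [apply cond_pos|].
intros x [[_ ne] hx]; simpl in *; unfold R_dist in *.
specialize (hd (x - r) ltac:(lra) hx).
now replace (r + (x - r)) with x in hd by ring.
Qed.

Lemma continue_in_of_continuous (f : R -> R) (D : R -> Prop) (r : R) :
  continuous f r -> continue_in f D r.
Proof.
intros h eps e0; apply continuity_pt_filterlim in h.
destruct (h eps e0) as [dl [dl0 hd]]; exists dl; split; [easy|].
intros x [[_ ne] hx]; apply hd; split; [split; [exact I|easy]|easy].
Qed.

Lemma newton_C2_on (d a : R) (f : R -> R) (D : R -> Prop) : 0 < d ->
  (forall t, continuous f t) -> (forall r, D r -> 0 <= r) ->
  C2_on D (fun r => a + newton d f r) (fun r => r * avg d f r)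
    (fun r => f r - (d - 1) * avg d f r).
Proof.
intros d0 cf dom r Dr; specialize (dom r Dr); split; [|split].
- apply D_in_of_is_derive; eapply is_derive_eq.
  + apply (is_derive_plus (fun _ => a) (newton d f)).
    * apply @is_derive_const.
    * now apply is_derive_newton.
  + unfold plus, zero; simpl; ring.
- destruct (Rle_lt_or_eq_dec 0 r dom) as [r0 | <-].
  { now apply D_in_of_is_derive, is_derive_mul_avg. }
  (* At [0] the difference quotient of [s * avg d f s] is [avg d f] itself, with limit
     [f 0 / d = f 0 - (d - 1) * (f 0 / d)]. *)
  assert (c := avg_continuous d f 0 d0 cf).
  intros eps e0; destruct (continue_in_of_continuous _ D 0 c eps e0) as [al [a0 h]].
  exists al; split; [easy|]; intros x hx; specialize (h x hx).
  destruct hx as [[_ ne] _]; simpl in *; unfold R_dist in *.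
  rewrite avg_0 in *.
  replace ((x * avg d f x - 0 * (f 0 / d)) / (x - 0)) with (avg d f x) by (field; lra).
  now replace (f 0 - (d - 1) * (f 0 / d)) with (f 0 / d) by (field; lra).
- apply continue_in_of_continuous.
  apply (continuous_minus f (fun r => (d - 1) * avg d f r)); [apply cf|].
  apply (continuous_scal_r (d - 1) (avg d f)); now apply avg_continuous.
Qed.

Lemma newton_radial (d a : R) (f : R -> R) : 0 < d -> (forall t, continuous f t) ->
  radial d (fun r => a + newton d f r) (fun r => r * avg d f r) f.
Proof.
intros d0 cf; eapply radial_of_C2_on; [easy|apply newton_C2_on; try easy| |].
- now intros r [].
- simpl; ring.
- intros r r0; simpl; field; lra.
Qed.

(** A weight for a Bielecki norm: its logarithmic derivative is [2 r (al + be r^2) / d]. *)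
Definition envelope (d al be r : R) : R := exp ((al * r ^ 2 + be / 2 * r ^ 4) / d).

Lemma envelope_mono (d al be s r : R) : 0 < d -> 0 <= al -> 0 <= be -> 0 <= s <= r ->
  envelope d al be s <= envelope d al be r.
Proof.
intros d0 al0 be0 sr; unfold envelope.
assert (h : (al * s ^ 2 + be / 2 * s ^ 4) / d <= (al * r ^ 2 + be / 2 * r ^ 4) / d).
{ apply Rmult_le_compat_r; [apply Rlt_le; now apply Rinv_0_lt_compat|].
  pose proof (pow_incr s r 2 sr); pose proof (pow_incr s r 4 sr).
  apply Rplus_le_compat; apply Rmult_le_compat_l; lra. }
destruct h as [h | ->]; [|lra]; now apply Rlt_le, exp_increasing.
Qed.

Lemma envelope_ge_1 (d al be r : R) : 0 < d -> 0 <= al -> 0 <= be -> 0 <= r ->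
  1 <= envelope d al be r.
Proof.
intros d0 al0 be0 r0.
apply Rle_trans with (envelope d al be 0); [|apply envelope_mono; lra].
unfold envelope; replace ((al * 0 ^ 2 + be / 2 * 0 ^ 4) / d) with 0 by (field; lra).
rewrite exp_0; lra.
Qed.

(** The weight is chosen so that [newton] maps [(al + be t^2) * envelope] below
    [envelope / 2]: a contraction on the whole half-line. *)
Lemma newton_diff_bound (d al be A r : R) (f g : R -> R) :
  0 < d -> 0 <= al -> 0 <= be -> 0 <= A ->
  (forall t, continuous f t) -> (forall t, continuous g t) ->
  (forall t, 0 <= t -> Rabs (f t - g t) <= A * ((al + be * t ^ 2) * envelope d al be t)) ->
  0 <= r -> Rabs (newton d f r - newton d g r) <= A / 2 * envelope d al be r.
Proof.
intros d0 al0 be0 A0 cf cg bd r0.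
pose (E := envelope d al be).
assert (dE : forall s, is_derive E s (E s * (2 * s / d * (al + be * s ^ 2)))).
{ intros s; unfold E, envelope; auto_derive; [easy|].
  simpl; unfold Rdiv; match goal with |- context [exp ?x] => generalize (exp x) end.
  intros; field; lra. }
(* The bound on [f - g] is nondecreasing, so on [[0, s]] it may be replaced by its value at [s]; the
   result is exactly [A / 2] times the derivative of the envelope. *)
assert (ab : forall s, 0 <= s -> Rabs (s * avg d f s - s * avg d g s) <=
  A / 2 * (E s * (2 * s / d * (al + be * s ^ 2)))).
{ intros s s0; rewrite <- Rmult_minus_distr_l, Rabs_mult, (Rabs_right s) by lra.
  replace (A / 2 * (E s * (2 * s / d * (al + be * s ^ 2))))
    with (s * (A * ((al + be * s ^ 2) * E s) / d)) by (field; lra).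
  apply Rmult_le_compat_l; [easy|].
  apply avg_diff_bound; try easy; intros t ht.
  eapply Rle_trans; [apply bd; lra|].
  apply Rmult_le_compat_l; [easy|].
  assert (p : t ^ 2 <= s ^ 2) by (apply pow_incr; lra).
  pose proof (pow2_ge_0 t).
  apply Rmult_le_compat; [nra|apply Rlt_le, exp_pos|nra|now apply envelope_mono]. }
assert (E0 : 1 <= E 0) by (apply envelope_ge_1; lra).
assert (side : forall sg, (sg = 1 \/ sg = -1) ->
  0 <= A / 2 * E r + sg * (newton d f r - newton d g r)).
{ intros sg hs.
  apply Rle_trans with (A / 2 * E 0 + sg * (newton d f 0 - newton d g 0)).
  { rewrite !newton_0; nra. }
  apply (nondecreasing_of_derive
    (fun r => A / 2 * E r + sg * (newton d f r - newton d g r))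
    (fun s => A / 2 * (E s * (2 * s / d * (al + be * s ^ 2))) +
      sg * (s * avg d f s - s * avg d g s))); [easy| |].
  - intros x hx.
    apply (is_derive_plus (fun r => A / 2 * E r)
      (fun r => sg * (newton d f r - newton d g r))).
    + apply is_derive_scal, dE.
    + apply is_derive_scal, (is_derive_minus (newton d f) (newton d g));
        now apply is_derive_newton.
  - intros x hx; specialize (ab x ltac:(lra)); apply Rabs_le_between in ab.
    destruct hs as [-> | ->]; lra. }
pose proof (side 1 ltac:(now left)); pose proof (side (-1) ltac:(now right)).
fold (E r); apply Rabs_le; lra.
Qed.

(** * The truncated initial value problem *)

(** The cut at [M] gives Lipschitz bounds whose coefficients grow at most quadratically in [r], so
    that solutions are global; the cut at [0] removes the source where [u < 0]. *)
Definition clamp (M x : R) : R := Rmax 0 (Rmin x M).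

Lemma clamp_bounds (M x : R) : 0 <= M -> 0 <= clamp M x <= M.
Proof.
intros M0; unfold clamp; split; [apply Rmax_l|].
apply Rmax_lub; [easy|apply Rmin_r].
Qed.

Lemma clamp_id (M x : R) : 0 <= x <= M -> clamp M x = x.
Proof. intros hx; unfold clamp; rewrite Rmin_left, Rmax_right; lra. Qed.

Lemma clamp_neg (M x : R) : x <= 0 -> clamp M x = 0.
Proof.
intros hx; unfold clamp; apply Rmax_left.
apply Rle_trans with x; [apply Rmin_l|easy].
Qed.

Lemma clamp_le (M x : R) : 0 <= x -> clamp M x <= x.
Proof. intros hx; unfold clamp; apply Rmax_lub; [easy|apply Rmin_l]. Qed.

Lemma clamp_lipschitz (M x y : R) : Rabs (clamp M x - clamp M y) <= Rabs (x - y).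
Proof.
unfold clamp, Rmax, Rmin; repeat destruct Rle_dec; unfold Rabs;
  repeat destruct Rcase_abs; lra.
Qed.

Lemma clamp_continuous (M : R) (u : R -> R) (t : R) :
  continuous u t -> continuous (fun t => clamp M (u t)) t.
Proof.
intros cu; apply continuity_pt_filterlim; apply continuity_pt_filterlim in cu.
intros eps e0; destruct (cu eps e0) as [al [a0 h]].
exists al; split; [easy|]; intros x hx; specialize (h x hx).
simpl in *; unfold R_dist in *.
eapply Rle_lt_trans; [apply clamp_lipschitz|easy].
Qed.

Definition potential (d M : R) (u : R -> R) : R -> R :=
  newton d (fun t => clamp M (u t) ^ 2).

Definition source (d M : R) (u : R -> R) (t : R) : R :=
  (potential d M u t - 1) * clamp M (u t).

Definition picard_map (d M a : R) (u : R -> R) (r : R) : R := a + newton d (source d M u) r.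

Lemma clamp_sq_continuous (M : R) (u : R -> R) (t : R) :
  (forall t, continuous u t) -> continuous (fun t => clamp M (u t) ^ 2) t.
Proof.
intros cu; apply continuous_ext with (fun t => clamp M (u t) * clamp M (u t)).
{ intros x; simpl; ring_R. }
apply (continuous_mult (fun t => clamp M (u t)) (fun t => clamp M (u t)));
  apply clamp_continuous, cu.
Qed.

Lemma source_continuous (d M : R) (u : R -> R) (t : R) : 0 < d ->
  (forall t, continuous u t) -> continuous (source d M u) t.
Proof.
intros d0 cu; unfold source.
apply (continuous_mult (fun t => potential d M u t - 1) (fun t => clamp M (u t))).
- apply (continuous_minus (potential d M u) (fun _ => 1)); [|apply continuous_const].
  apply newton_continuous; [easy|]; intros; now apply clamp_sq_continuous.
- apply clamp_continuous, cu.
Qed.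

Lemma picard_map_continuous (d M a : R) (u : R -> R) (t : R) : 0 < d ->
  (forall t, continuous u t) -> continuous (picard_map d M a u) t.
Proof.
intros d0 cu; unfold picard_map.
apply (continuous_plus (fun _ => a) (newton d (source d M u))); [apply continuous_const|].
apply newton_continuous; [easy|]; intros; now apply source_continuous.
Qed.

Lemma potential_bounds (d M r : R) (u : R -> R) : 0 < d -> 0 <= M ->
  (forall t, continuous u t) -> 0 <= r ->
  0 <= potential d M u r <= M ^ 2 / (2 * d) * r ^ 2.
Proof.
intros d0 M0 cu r0.
pose proof (newton_radial d 0 (fun t => clamp M (u t) ^ 2) d0
  (fun t => clamp_sq_continuous M u t cu)) as h.
fold (potential d M u) in h.
assert (P0 : potential d M u 0 = 0) by apply newton_0.
split.
- assert (H := radial_nondecreasing d _ _ _ r 0 r h ltac:(lra) ltac:(lra)).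
  simpl in H; rewrite P0 in H; enough (0 + 0 <= 0 + potential d M u r) by lra.
  apply H; intros; pose proof (pow2_ge_0 (clamp M (u t))); simpl in *; lra.
- pose proof (radial_lincomb d (M ^ 2 / (2 * d)) (-1) _ _ _ _ _ _ (radial_sq d d0) h) as k.
  assert (H := radial_nondecreasing d _ _ _ r 0 r k ltac:(lra) ltac:(lra)).
  cbv beta in H; rewrite P0 in H.
  enough (M ^ 2 / (2 * d) * 0 ^ 2 + -1 * (0 + 0) <=
    M ^ 2 / (2 * d) * r ^ 2 + -1 * (0 + potential d M u r)) by (simpl in *; lra).
  apply H; intros t ht.
  replace (M ^ 2 / (2 * d) * (2 * d)) with (M ^ 2) by (field; lra).
  pose proof (clamp_bounds M (u t) M0) as [c1 c2].
  pose proof (pow_incr _ _ 2 (conj c1 c2)); lra.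
Qed.

(** The coefficients are those of the Lipschitz bound on [source]: [1 + M^2 t^2 / (2 d)] bounds
    [|V - 1|], and the remaining [M^2] accounts for the variation of the potential. *)
Definition weight (d M : R) : R -> R := envelope d (M ^ 2 + 1) (M ^ 2 / (2 * d)).

Lemma weight_coeffs (d M : R) : 0 < d -> 1 <= M ^ 2 + 1 /\ 0 <= M ^ 2 / (2 * d).
Proof.
intros d0; pose proof (pow2_ge_0 M); split; [lra|].
apply Rdiv_le_0_compat; lra.
Qed.

Lemma weight_ge_1 (d M r : R) : 0 < d -> 0 <= r -> 1 <= weight d M r.
Proof.
intros d0 r0; destruct (weight_coeffs d M d0); apply envelope_ge_1; lra.
Qed.

Lemma source_diff_bound (d M A t : R) (u w : R -> R) : 0 < d -> 0 <= M -> 0 <= A ->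
  (forall t, continuous u t) -> (forall t, continuous w t) ->
  (forall t, 0 <= t -> Rabs (u t - w t) <= A * weight d M t) -> 0 <= t ->
  Rabs (source d M u t - source d M w t) <=
    A * ((M ^ 2 + 1 + M ^ 2 / (2 * d) * t ^ 2) * weight d M t).
Proof.
intros d0 M0 A0 cu cw bd t0.
destruct (weight_coeffs d M d0) as [al1 be0].
(* The squares differ by at most [2 M A] times the weight; as [M^2 + 1 >= 1], the factor required by
   [newton_diff_bound] can be inserted. *)
assert (pd : Rabs (potential d M u t - potential d M w t) <=
  2 * M * A / 2 * weight d M t).
{ apply newton_diff_bound; try easy; try lra; try (intros; now apply clamp_sq_continuous).
  - nra.
  - intros s s0; fold (weight d M s).
    pose proof (weight_ge_1 d M s d0 s0) as w1.
    pose proof (clamp_bounds M (u s) M0); pose proof (clamp_bounds M (w s) M0).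
    replace (clamp M (u s) ^ 2 - clamp M (w s) ^ 2)
      with ((clamp M (u s) + clamp M (w s)) * (clamp M (u s) - clamp M (w s))) by ring.
    rewrite Rabs_mult, (Rabs_right (_ + _)) by lra.
    apply Rle_trans with (2 * M * (A * weight d M s)).
    + apply Rmult_le_compat; try lra; [apply Rabs_pos|].
      eapply Rle_trans; [apply clamp_lipschitz|now apply bd].
    + rewrite Rmult_assoc, (Rmult_assoc 2 M A), Rmult_assoc.
      apply Rmult_le_compat_l; [lra|].
      rewrite Rmult_assoc; apply Rmult_le_compat_l; [easy|].
      apply Rmult_le_compat_l; [easy|].
      assert (0 <= M ^ 2 / (2 * d) * s ^ 2) by (apply Rmult_le_pos; [easy|apply pow2_ge_0]).
      nra. }
pose proof (potential_bounds d M t w d0 M0 cw t0) as pb.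
pose proof (clamp_bounds M (u t) M0).
pose proof (weight_ge_1 d M t d0 t0) as w1.
unfold source.
replace ((potential d M u t - 1) * clamp M (u t) - (potential d M w t - 1) * clamp M (w t))
  with ((potential d M u t - potential d M w t) * clamp M (u t) +
    (potential d M w t - 1) * (clamp M (u t) - clamp M (w t))) by ring.
eapply Rle_trans; [apply Rabs_triang|]; rewrite !Rabs_mult.
rewrite (Rabs_right (clamp M (u t))) by lra.
assert (q : Rabs (potential d M w t - 1) <= 1 + M ^ 2 / (2 * d) * t ^ 2)
  by (apply Rabs_le; lra).
assert (Rabs (clamp M (u t) - clamp M (w t)) <= A * weight d M t)
  by (eapply Rle_trans; [apply clamp_lipschitz|now apply bd]).
replace (A * ((M ^ 2 + 1 + M ^ 2 / (2 * d) * t ^ 2) * weight d M t))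
  with (2 * M * A / 2 * weight d M t * M +
    (1 + M ^ 2 / (2 * d) * t ^ 2) * (A * weight d M t)) by (field; lra).
apply Rplus_le_compat; apply Rmult_le_compat; try lra; apply Rabs_pos.
Qed.

(** Contraction by [1/2] in the weighted norm; the two starting values enter separately, which also
    yields Lipschitz dependence on them. *)
Lemma picard_map_diff_bound (d M A a b r : R) (u w : R -> R) :
  0 < d -> 0 <= M -> 0 <= A ->
  (forall t, continuous u t) -> (forall t, continuous w t) ->
  (forall t, 0 <= t -> Rabs (u t - w t) <= A * weight d M t) -> 0 <= r ->
  Rabs (picard_map d M a u r - picard_map d M b w r) <=
    Rabs (a - b) + A / 2 * weight d M r.
Proof.
intros d0 M0 A0 cu cw bd r0; destruct (weight_coeffs d M d0) as [al1 be0].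
unfold picard_map.
replace (a + newton d (source d M u) r - (b + newton d (source d M w) r))
  with (a - b + (newton d (source d M u) r - newton d (source d M w) r)) by ring.
eapply Rle_trans; [apply Rabs_triang|].
apply Rplus_le_compat_l, newton_diff_bound; try easy; try lra.
- intros; now apply source_continuous.
- intros; now apply source_continuous.
- intros t t0; now apply source_diff_bound.
Qed.

(** * Picard iteration and dependence on the initial value *)

Definition picard (d M a : R) (n : nat) : R -> R := Nat.iter n (picard_map d M a) (fun _ => a).

Lemma picard_continuous (d M a : R) (n : nat) (t : R) : 0 < d ->
  continuous (picard d M a n) t.
Proof.
intros d0; revert t; induction n as [|n IH]; intros t; simpl.
- apply continuous_const.
- now apply picard_map_continuous.
Qed.

Lemma picard_step_bound (d M a : R) (n : nat) (r : R) : 0 < d -> 0 <= M -> 0 <= r ->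
  Rabs (picard d M a (S n) r - picard d M a n r) <= M * (/ 2) ^ n * weight d M r.
Proof.
intros d0 M0; destruct (weight_coeffs d M d0) as [al1 be0].
revert r; induction n as [|n IH]; intros r r0.
- simpl; unfold picard_map.
  (* The first increment is read as a difference of potentials with sources [source d M a] and [0],
     so that [newton_diff_bound] covers it. *)
  replace (a + newton d (source d M (fun _ => a)) r - a)
    with (newton d (source d M (fun _ => a)) r - newton d (fun _ => 0) r).
  + apply Rle_trans with (M / 2 * weight d M r).
    * apply newton_diff_bound; try easy; try lra;
        [intros; apply source_continuous; try easy; intros; apply continuous_const
        |intros; apply continuous_const|].
      intros t t0; fold (weight d M t); unfold source.
      pose proof (potential_bounds d M t (fun _ => a) d0 M0
        (fun t => continuous_const a t) t0) as pb.
      pose proof (clamp_bounds M a M0) as cb.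
      pose proof (weight_ge_1 d M t d0 t0) as w1.
      rewrite Rminus_0_r, Rabs_mult, Rmult_comm, (Rabs_right (clamp M a)) by lra.
      apply Rmult_le_compat; try lra; [apply Rabs_pos|].
      apply Rle_trans with (1 + M ^ 2 / (2 * d) * t ^ 2); [apply Rabs_le; lra|].
      pose proof (pow2_ge_0 M); nra.
    * pose proof (weight_ge_1 d M r d0 r0); nra.
  + assert (z : newton d (fun _ => 0) r = 0); [|rewrite z; ring].
    unfold newton; apply is_RInt_unique.
    apply is_RInt_ext with (fun _ => 0).
    * intros x _; rewrite avg_const by easy; unfold Rdiv; ring_R.
    * pose proof (is_RInt_const 0 r 0) as h.
      unfold scal in h; simpl in h; unfold mult in h; simpl in h.
      now rewrite Rmult_0_r in h.
- change (picard d M a (S (S n))) with (picard_map d M a (picard d M a (S n))).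
  change (picard d M a (S n)) with (picard_map d M a (picard d M a n)) at 2.
  eapply Rle_trans.
  + apply (picard_map_diff_bound d M (M * (/ 2) ^ n)); try easy.
    * apply Rmult_le_pos; [easy|apply pow_le; lra].
    * intros; now apply picard_continuous.
    * intros; now apply picard_continuous.
  + rewrite Rminus_diag, Rabs_R0; right; simpl; field.
Qed.

(** The exact partial geometric sum, with its factor [1 - (1/2)^k], is kept so that the induction on
    [k] closes. *)
Lemma picard_tail_bound (d M a : R) (n k : nat) (r : R) : 0 < d -> 0 <= M -> 0 <= r ->
  Rabs (picard d M a (n + k) r - picard d M a n r) <=
    2 * M * (/ 2) ^ n * (1 - (/ 2) ^ k) * weight d M r.
Proof.
intros d0 M0 r0; induction k as [|k IH].
- rewrite Nat.add_0_r, Rminus_diag, Rabs_R0; simpl; lra.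
- rewrite Nat.add_succ_r.
  replace (picard d M a (S (n + k)) r - picard d M a n r)
    with (picard d M a (S (n + k)) r - picard d M a (n + k) r +
      (picard d M a (n + k) r - picard d M a n r)) by ring.
  eapply Rle_trans; [apply Rabs_triang|].
  eapply Rle_trans; [apply Rplus_le_compat; [now apply picard_step_bound|exact IH]|].
  rewrite pow_add; right; simpl; field.
Qed.

Lemma picard_tail_bound' (d M a : R) (n m : nat) (r : R) : 0 < d -> 0 <= M -> 0 <= r ->
  (n <= m)%nat ->
  Rabs (picard d M a m r - picard d M a n r) <= 2 * M * weight d M r * (/ 2) ^ n.
Proof.
intros d0 M0 r0 nm; replace m with (n + (m - n))%nat by lia.
eapply Rle_trans; [now apply picard_tail_bound|].
pose proof (weight_ge_1 d M r d0 r0).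
assert (0 <= (/ 2) ^ (m - n)) by (apply pow_le; lra).
assert (0 <= 2 * M * weight d M r * (/ 2) ^ n).
{ apply Rmult_le_pos; [nra|apply pow_le; lra]. }
nra.
Qed.

Lemma half_pow_small (C eps : R) : 0 < eps ->
  exists N, forall n, (N <= n)%nat -> C * (/ 2) ^ n < eps.
Proof.
intros e0; pose proof (is_lim_seq_geom (/ 2) ltac:(rewrite Rabs_right; lra)) as l.
apply (is_lim_seq_scal_l _ C) in l; rewrite Rbar_mult_0_r in l.
apply is_lim_seq_spec in l; destruct (l (mkposreal eps e0)) as [N h].
exists N; intros n hn; specialize (h n hn); simpl in h.
apply Rabs_def2 in h; lra.
Qed.

(** The estimates hold for [r >= 0] only, while the lemmas on [newton] ask for continuity on the
    whole line; the limit is therefore extended as an even function. *)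
Definition picard_limit (d M a r : R) : R :=
  real (Lim_seq (fun n => picard d M a n (Rabs r))).

Lemma picard_limit_correct (d M a r : R) : 0 < d -> 0 <= M -> 0 <= r ->
  is_lim_seq (fun n => picard d M a n r) (picard_limit d M a r).
Proof.
intros d0 M0 r0; unfold picard_limit; rewrite Rabs_right by lra.
apply Lim_seq_correct', ex_lim_seq_cauchy_corr; intros eps.
destruct (half_pow_small (2 * M * weight d M r) eps (cond_pos eps)) as [N hN].
exists N; intros n m hn hm.
destruct (Nat.le_ge_cases n m) as [nm | mn].
- rewrite Rabs_minus_sym.
  eapply Rle_lt_trans; [now apply picard_tail_bound'|now apply hN].
- eapply Rle_lt_trans; [now apply picard_tail_bound'|now apply hN].
Qed.

Lemma Rabs_lim_le (u : nat -> R) (l c b : R) :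
  is_lim_seq u l -> (exists N, forall n, (N <= n)%nat -> Rabs (u n - c) <= b) ->
  Rabs (l - c) <= b.
Proof.
intros lim bd.
assert (h : is_lim_seq (fun n => Rabs (u n - c)) (Rabs (l - c))).
{ apply (is_lim_seq_abs (fun n => u n - c) (l - c)).
  apply (is_lim_seq_minus' u (fun _ => c)); [easy|apply is_lim_seq_const]. }
apply (is_lim_seq_le_loc (fun n => Rabs (u n - c)) (fun _ => b) (Rabs (l - c)) b);
  [exact bd|exact h|apply is_lim_seq_const].
Qed.

Lemma picard_limit_bound (d M a : R) (n : nat) (r : R) : 0 < d -> 0 <= M -> 0 <= r ->
  Rabs (picard_limit d M a r - picard d M a n r) <= 2 * M * weight d M r * (/ 2) ^ n.
Proof.
intros d0 M0 r0.
apply (Rabs_lim_le (fun n => picard d M a n r)); [now apply picard_limit_correct|].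
exists n; intros m nm; now apply picard_tail_bound'.
Qed.

Lemma picard_limit_continuous (d M a r : R) : 0 < d -> 0 <= M ->
  continuous (picard_limit d M a) r.
Proof.
intros d0 M0; apply continuity_pt_filterlim; intros eps e0.
destruct (weight_coeffs d M d0) as [al1 be0].
(* The weight at [|r| + 1] dominates the weight at all points within distance [1] of [r], so this
   [n] serves a whole neighbourhood. *)
destruct (half_pow_small (2 * M * weight d M (Rabs r + 1)) (eps / 3) ltac:(lra)) as [n hn].
specialize (hn n (le_n n)).
assert (c : continuous (fun r => picard d M a n (Rabs r)) r).
{ apply continuous_comp; [apply continuous_Rabs|now apply picard_continuous]. }
apply continuity_pt_filterlim in c.
destruct (c (eps / 3) ltac:(lra)) as [al [a0 h]].
exists (Rmin al 1); split; [apply Rmin_glb_lt; lra|]; intros x [xx hx].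
pose proof (Rmin_l al 1); pose proof (Rmin_r al 1).
change (Rabs (x - r) < Rmin al 1) in hx.
change (Rabs (picard_limit d M a x - picard_limit d M a r) < eps).
specialize (h x (conj xx (Rlt_le_trans _ _ _ hx (Rmin_l al 1)))).
change (Rabs (picard d M a n (Rabs x) - picard d M a n (Rabs r)) < eps / 3) in h.
assert (near : forall y, Rabs y <= Rabs r + 1 ->
  Rabs (picard_limit d M a y - picard d M a n (Rabs y)) < eps / 3).
{ intros y hy.
  replace (picard_limit d M a y) with (picard_limit d M a (Rabs y))
    by (unfold picard_limit; now rewrite Rabs_Rabsolu).
  eapply Rle_lt_trans; [apply picard_limit_bound; try easy; apply Rabs_pos|].
  apply Rle_lt_trans with (2 := hn).
  apply Rmult_le_compat_r; [apply pow_le; lra|].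
  apply Rmult_le_compat_l; [lra|].
  apply envelope_mono; try lra; split; [apply Rabs_pos|easy]. }
assert (hx' : Rabs x <= Rabs r + 1).
{ replace x with (r + (x - r)) by ring.
  eapply Rle_trans; [apply Rabs_triang|lra]. }
pose proof (near x hx') as n1; pose proof (near r ltac:(lra)) as n2.
apply Rabs_def2 in n1; apply Rabs_def2 in n2; apply Rabs_def2 in h.
apply Rabs_def1; lra.
Qed.

(** By the contraction bound and the tail bound, both sides are within a multiple of [(1/2)^n] of
    the iterate of index [n + 1]. *)
Lemma picard_limit_fixed (d M a r : R) : 0 < d -> 0 <= M -> 0 <= r ->
  picard_limit d M a r = picard_map d M a (picard_limit d M a) r.
Proof.
intros d0 M0 r0; symmetry; apply Rminus_diag_uniq.
set (x := picard_map d M a (picard_limit d M a) r).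
set (y := picard_limit d M a r).
pose (A := 2 * M).
assert (tail : forall n t, 0 <= t ->
  Rabs (picard_limit d M a t - picard d M a n t) <= A * (/ 2) ^ n * weight d M t).
{ intros n t t0; eapply Rle_trans; [now apply picard_limit_bound|].
  right; unfold A; ring. }
assert (main : forall n, Rabs (x - y) <= 2 * A * weight d M r * (/ 2) ^ n).
{ intros n.
  assert (An : 0 <= A * (/ 2) ^ n) by (apply Rmult_le_pos; [unfold A; lra|apply pow_le; lra]).
  assert (e1 : Rabs (x - picard d M a (S n) r) <=
    Rabs (a - a) + A * (/ 2) ^ n / 2 * weight d M r).
  { apply picard_map_diff_bound; try easy.
    - intros; now apply picard_limit_continuous.
    - intros; now apply picard_continuous.
    - now apply tail. }
  pose proof (tail (S n) r r0) as e2; fold y in e2.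
  rewrite Rminus_diag, Rabs_R0 in e1.
  change ((/ 2) ^ S n) with (/ 2 * (/ 2) ^ n) in e2.
  pose proof (weight_ge_1 d M r d0 r0).
  assert (0 <= A * (/ 2) ^ n * weight d M r) by (apply Rmult_le_pos; lra).
  replace (x - y) with (x - picard d M a (S n) r - (y - picard d M a (S n) r)) by ring.
  eapply Rle_trans; [apply Rabs_triang|]; rewrite Rabs_Ropp; nra. }
destruct (Rle_lt_or_eq_dec 0 _ (Rabs_pos (x - y))) as [pos | z].
- destruct (half_pow_small (2 * A * weight d M r) _ pos) as [N hN].
  specialize (hN N (le_n N)); specialize (main N); lra.
- destruct (Req_dec (x - y) 0) as [|ne]; [easy|].
  now apply Rabs_no_R0 in ne; rewrite <- z in ne.
Qed.

(** The constant [2] reproduces itself: one step gives [|a - b| + (2 |a - b| / 2) * weight], and the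
    weight is at least [1]. *)
Lemma picard_dependence (d M a b r : R) (n : nat) : 0 < d -> 0 <= M -> 0 <= r ->
  Rabs (picard d M a n r - picard d M b n r) <= 2 * Rabs (a - b) * weight d M r.
Proof.
intros d0 M0; pose proof (Rabs_pos (a - b)) as p.
revert r; induction n as [|n IH]; intros r r0; pose proof (weight_ge_1 d M r d0 r0).
- simpl; nra.
- eapply Rle_trans.
  + apply (picard_map_diff_bound d M (2 * Rabs (a - b)) a b); try easy; try lra.
    * intros; now apply picard_continuous.
    * intros; now apply picard_continuous.
  + nra.
Qed.

Lemma picard_limit_dependence (d M a b r : R) : 0 < d -> 0 <= M -> 0 <= r ->
  Rabs (picard_limit d M a r - picard_limit d M b r) <= 2 * Rabs (a - b) * weight d M r.
Proof.
intros d0 M0 r0.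
pose proof (is_lim_seq_minus' _ _ _ _ (picard_limit_correct d M a r d0 M0 r0)
  (picard_limit_correct d M b r d0 M0 r0)) as l.
rewrite <- (Rminus_0_r (picard_limit d M a r - picard_limit d M b r)).
apply (Rabs_lim_le _ _ _ _ l); exists O; intros n _.
rewrite Rminus_0_r; now apply picard_dependence.
Qed.

Definition truncated_solution (d M a : R) (u V : R -> R) : Prop :=
  exists u1 u2 V1 V2 : R -> R,
    C2_on (Ico0 p_infty) u u1 u2 /\ C2_on (Ico0 p_infty) V V1 V2 /\
    (forall r, 0 < r ->
       u2 r + (d - 1) / r * u1 r = (V r - 1) * clamp M (u r) /\
       V2 r + (d - 1) / r * V1 r = clamp M (u r) ^ 2) /\
    u 0 = a /\ u1 0 = 0 /\ V 0 = 0 /\ V1 0 = 0.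

Lemma truncated_solutions_exist (d M : R) : 0 < d -> 0 <= M ->
  exists (U V : R -> R -> R) (E : R -> R),
    (forall a, truncated_solution d M a (U a) (V a)) /\
    (forall a b r, 0 <= r -> Rabs (U a r - U b r) <= Rabs (a - b) * E r).
Proof.
intros d0 M0.
pose (W := picard_limit d M).
assert (cW : forall a t, continuous (W a) t) by (intros; now apply picard_limit_continuous).
(* On the half-line this equals [W a] by the fixed-point equation; in the form [a + newton] it has
   the explicit derivatives of [newton_C2_on]. *)
exists (fun a => picard_map d M a (W a)).
exists (fun a r => 0 + potential d M (W a) r), (fun r => 2 * weight d M r).
split.
- intros a.
  exists (fun r => r * avg d (source d M (W a)) r).
  exists (fun r => source d M (W a) r - (d - 1) * avg d (source d M (W a)) r).
  exists (fun r => r * avg d (fun t => clamp M (W a t) ^ 2) r).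
  exists (fun r => clamp M (W a r) ^ 2 - (d - 1) * avg d (fun t => clamp M (W a t) ^ 2) r).
  split; [|split; [|split; [|repeat split]]].
  + apply newton_C2_on; [easy| |now intros r []].
    intros; now apply source_continuous.
  + apply newton_C2_on; [easy| |now intros r []].
    intros; now apply clamp_sq_continuous.
  + intros r r0; unfold W at 4 6; rewrite <- picard_limit_fixed by lra; fold (W a).
    split; [unfold source at 1|]; field; lra.
  + unfold picard_map; rewrite newton_0; ring.
  + ring.
  + unfold potential; rewrite newton_0; ring.
  + ring.
- intros a b r r0; unfold W; rewrite <- !picard_limit_fixed by easy.
  eapply Rle_trans; [now apply picard_limit_dependence|right; ring].
Qed.

(** * Shooting *)

Lemma radial_of_truncated_solution (d M a : R) (u V : R -> R) : 0 < d ->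
  truncated_solution d M a u V ->
  exists u1 V1, radial d u u1 (fun r => (V r - 1) * clamp M (u r)) /\
    radial d V V1 (fun r => clamp M (u r) ^ 2) /\ u 0 = a /\ V 0 = 0.
Proof.
intros d0 [u1 [u2 [V1 [V2 [cu [cV [eq [i0 [i1 [j0 j1]]]]]]]]]].
exists u1, V1; split; [|split; [|easy]].
- apply (radial_of_C2_on d u u1 u2); try easy; intros; now apply eq.
- apply (radial_of_C2_on d V V1 V2); try easy; intros; now apply eq.
Qed.

(** As [0 <= u <= a <= M], the truncation is inactive. If [u] stayed above some [eps > 0], the
    quartic term of [radial_growth] would push it above [a]. *)
Lemma G_of_nonincreasing (d M a : R) (u V : R -> R) : 0 < d -> 0 < a <= M ->
  truncated_solution d M a u V ->
  (forall r, 0 <= r -> 0 <= u r) -> (forall s r, 0 <= s <= r -> u r <= u s) -> G d a.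
Proof.
intros d0 ha ts nn dec; split; [lra|exists u, V].
destruct (radial_of_truncated_solution d M a u V d0 ts) as [w1 [W1 [hu [hV [i0 j0]]]]].
assert (le : forall r, 0 <= r -> 0 <= u r <= a).
{ intros r r0; specialize (nn r r0); specialize (dec 0 r ltac:(lra)); lra. }
assert (id : forall r, 0 <= r -> clamp M (u r) = u r).
{ intros r r0; specialize (le r r0); apply clamp_id; lra. }
split; [|split; [easy|]].
- destruct ts as [u1 [u2 [V1 [V2 [cu [cV [eq ini]]]]]]].
  exists u1, u2, V1, V2; split; [exact cu|split; [exact cV|split; [|exact ini]]].
  intros r r0 _; destruct (eq r r0) as [e1 e2].
  rewrite (id r) in e1 by lra; rewrite (id r) in e2 by lra; easy.
- apply is_lim_spec; intros eps; pose proof (cond_pos eps) as e0.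
  destruct (classic (exists R0, 0 <= R0 /\ u R0 < eps)) as [[R0 [R0p small]] | none].
  + exists R0; intros r rR; specialize (dec R0 r ltac:(lra)); specialize (nn r ltac:(lra)).
    apply Rabs_def1; lra.
  + exfalso.
    assert (ge : forall r, 0 <= r -> eps <= u r).
    { intros r r0; apply Rnot_lt_le; intros lt; apply none; now exists r. }
    assert (e3 : 0 < eps ^ 3) by now apply pow_lt.
    (* Growth on [[0, b]] together with [u b <= a] forces [eps^3 b^2 <= 4 a (d + 2)], while
       [eps^3 b] already exceeds this bound and [b > 1]. *)
    pose (b := 1 + 4 * a * (d + 2) / eps ^ 3).
    assert (b1 : 0 < 4 * a * (d + 2) / eps ^ 3) by (apply Rdiv_lt_0_compat; nra).
    pose proof (radial_growth d eps a b u w1 V W1 (fun r => clamp M (u r)) d0 ltac:(lra)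
      ltac:(unfold b; lra) hu hV j0) as H.
    assert (K := H ltac:(intros r hr; cbv beta; rewrite id by lra; split;
      [apply ge|apply le]; lra)).
    specialize (dec 0 b ltac:(unfold b; lra)).
    assert (L : eps ^ 3 * b ^ 4 / (8 * d * (d + 2)) <= a * b ^ 2 / (2 * d)) by lra.
    apply Rmult_le_compat_r with (r := 8 * d * (d + 2)) in L; [|nra].
    replace (eps ^ 3 * b ^ 4 / (8 * d * (d + 2)) * (8 * d * (d + 2)))
      with (eps ^ 3 * b ^ 2 * b ^ 2) in L by (field; lra).
    replace (a * b ^ 2 / (2 * d) * (8 * d * (d + 2)))
      with (4 * a * (d + 2) * b ^ 2) in L by (field; lra).
    assert (b_gt : 1 < b) by (unfold b; lra).
    assert (b2 : b <= b ^ 2) by nra.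
    apply Rmult_le_reg_r in L; [|lra].
    assert (e : eps ^ 3 * b = eps ^ 3 + 4 * a * (d + 2)) by (unfold b; field; lra).
    nra.
Qed.

(** [k = 1 - u - V] satisfies [k'' + (d-1)/r k' >= clamp M u * k], so that [V <= a < 1]. *)
Lemma truncated_nonincreasing_of_lt_1 (d M a : R) (u V : R -> R) (s r : R) :
  0 < d -> 0 <= M -> a < 1 -> truncated_solution d M a u V ->
  (forall t, 0 <= t -> 0 <= u t) -> 0 <= s <= r -> u r <= u s.
Proof.
intros d0 M0 a1 ts nn sr.
destruct (radial_of_truncated_solution d M a u V d0 ts) as [u1 [V1 [hu [hV [i0 j0]]]]].
assert (Vle : forall t, 0 <= t -> V t <= 1).
{ intros t t0.
  pose proof (radial_lincomb d (-1) 1 _ _ _ _ _ _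
    (radial_lincomb d 1 1 _ _ _ _ _ _ hu hV) (radial_const d 1 d0)) as h.
  assert (H := radial_sign_preserved d _ _ _ h); cbv beta in H.
  rewrite i0, j0 in H; specialize (H ltac:(lra)).
  assert (K : -1 * (1 * a + 1 * 0) + 1 * 1 <= -1 * (1 * u t + 1 * V t) + 1 * 1).
  { apply H; [|easy]; intros x x0 k.
    pose proof (clamp_bounds M (u x) M0).
    pose proof (clamp_le M (u x) (nn x ltac:(lra))).
    replace (-1 * (1 * ((V x - 1) * clamp M (u x)) + 1 * clamp M (u x) ^ 2) + 1 * 0)
      with (clamp M (u x) * (1 - V x - clamp M (u x))) by ring.
    apply Rmult_le_pos; lra. }
  specialize (nn t t0); lra. }
pose proof (radial_lincomb d (-1) 0 _ _ _ _ _ _ hu hu) as h.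
assert (H := radial_nondecreasing d _ _ _ r s r h sr ltac:(lra)); cbv beta in H.
enough (-1 * u s + 0 * u s <= -1 * u r + 0 * u r) by lra.
apply H; intros t ht; specialize (Vle t ltac:(lra)).
pose proof (clamp_bounds M (u t) M0); nra.
Qed.

(** The Laplacian of [u] is at least [-M], so [u >= M - M r^2 / (2 d) >= M / 2] up to [r = sqrt d].
    If [u <= M] there as well, [radial_growth] gives [M^2 d <= 32 (d + 2)], which fails for this
    [M]. *)
Lemma truncated_not_nonincreasing (d M : R) (u V : R -> R) :
  0 < d -> 1 + 32 * (d + 2) / d <= M -> truncated_solution d M M u V ->
  ~ (forall s r, 0 <= s <= r -> u r <= u s).
Proof.
intros d0 hM ts dec.
assert (q : 0 < 32 * (d + 2) / d) by (apply Rdiv_lt_0_compat; lra).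
destruct (radial_of_truncated_solution d M M u V d0 ts) as [u1 [V1 [hu [hV [i0 j0]]]]].
assert (Vge : forall t, 0 <= t -> 0 <= V t).
{ intros t t0; rewrite <- j0.
  apply (potential_nondecreasing d V V1 _ 0 t hV); lra. }
pose (b := sqrt d).
assert (bb : b ^ 2 = d) by (apply pow2_sqrt; lra).
assert (b0 : 0 < b) by now apply sqrt_lt_R0.
assert (ub : forall t, 0 <= t <= b -> M / 2 <= u t).
{ intros t ht.
  pose proof (radial_lincomb d 1 (M / (2 * d)) _ _ _ _ _ _ hu (radial_sq d d0)) as h.
  assert (H := radial_nondecreasing d _ _ _ t 0 t h ltac:(lra) ltac:(lra)); cbv beta in H.
  assert (K : 1 * u 0 + M / (2 * d) * 0 ^ 2 <= 1 * u t + M / (2 * d) * t ^ 2).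
  { apply H; intros x hx.
    replace (M / (2 * d) * (2 * d)) with M by (field; lra).
    pose proof (clamp_bounds M (u x) ltac:(lra)); specialize (Vge x ltac:(lra)).
    nra. }
  assert (t2 : t ^ 2 <= d) by (rewrite <- bb; apply pow_incr; lra).
  assert (M / (2 * d) * t ^ 2 <= M / 2).
  { replace (M / 2) with (M / (2 * d) * d) by (field; lra).
    apply Rmult_le_compat_l; [apply Rdiv_le_0_compat; lra|easy]. }
  rewrite i0 in K; simpl in *; lra. }
assert (bd : forall t, 0 < t < b -> M / 2 <= clamp M (u t) <= M).
{ intros t ht; specialize (ub t ltac:(lra)); specialize (dec 0 t ltac:(lra)).
  rewrite clamp_id; lra. }
pose proof (radial_growth d (M / 2) M b u u1 V V1 (fun r => clamp M (u r)) d0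
  ltac:(lra) ltac:(lra) hu hV j0 bd) as H.
specialize (dec 0 b ltac:(lra)).
replace (b ^ 4) with (d * d) in H by (rewrite <- bb; ring).
rewrite bb, i0 in H; rewrite i0 in dec.
assert (L : (M / 2) ^ 3 * (d * d) / (8 * d * (d + 2)) <= M * d / (2 * d)) by lra.
apply Rmult_le_compat_r with (r := 64 * (d + 2) / M) in L.
2: apply Rlt_le, Rdiv_lt_0_compat; lra.
replace ((M / 2) ^ 3 * (d * d) / (8 * d * (d + 2)) * (64 * (d + 2) / M))
  with (M * M * d) in L by (field; lra).
replace (M * d / (2 * d) * (64 * (d + 2) / M)) with (32 * (d + 2)) in L by (field; lra).
assert (e : (1 + 32 * (d + 2) / d) * d = d + 32 * (d + 2)) by (field; lra).
assert (f : (1 + 32 * (d + 2) / d) * d <= M * d) by (apply Rmult_le_compat_r; lra).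
assert (M * d <= M * (M * d)) by nra.
lra.
Qed.

(** Unlike the negative part itself, its square is differentiable at [0]. *)
Definition neg_sq (x : R) : R := Rmin x 0 ^ 2.

Lemma is_derive_neg_sq (x : R) : is_derive neg_sq x (2 * Rmin x 0).
Proof.
destruct (Rtotal_order x 0) as [neg | [-> | pos]].
- rewrite Rmin_left by lra.
  apply is_derive_ext_loc with (fun y => y ^ 2); [|auto_derive; [easy|ring]].
  apply (locally_interval _ x m_infty 0); try easy.
  intros y _ y0; simpl in y0; unfold neg_sq; now rewrite Rmin_left by lra.
- rewrite Rmin_left by lra; rewrite Rmult_0_r.
  apply is_derive_Reals; intros eps e0.
  exists (mkposreal eps e0); intros h h0 hh; simpl in hh.
  unfold neg_sq; rewrite (Rmin_left 0 0), Rplus_0_l, Rminus_0_r by lra.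
  apply Rabs_def2 in hh.
  unfold Rmin; destruct (Rle_dec h 0).
  + replace ((h ^ 2 - 0 ^ 2) / h) with h by (field; lra); apply Rabs_def1; lra.
  + replace ((0 ^ 2 - 0 ^ 2) / h) with 0 by (field; lra); now rewrite Rabs_R0.
- rewrite Rmin_right by lra.
  apply is_derive_ext_loc with (fun y => 0).
  2: rewrite Rmult_0_r; apply @is_derive_const.
  apply (locally_interval _ x 0 p_infty); try easy.
  intros y y0 _; simpl in y0; unfold neg_sq; rewrite Rmin_right by lra; simpl; ring_R.
Qed.

(* With [m = min u 0], the source vanishes where [m] does not: [flux u * m^2] is
   nonincreasing, so [u' <= 0] where [u < 0]; then [m^2] is nondecreasing. *)
Lemma truncated_stays_negative (d M x r : R) (u u1 V : R -> R) :
  radial d u u1 (fun r => (V r - 1) * clamp M (u r)) ->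
  0 < x <= r -> u x < 0 -> u1 r <= 0.
Proof.
intros hu xr ux.
assert (dm : forall t, 0 < t ->
  is_derive (fun t => neg_sq (u t)) t (u1 t * (2 * Rmin (u t) 0))).
{ intros t t0; apply (is_derive_comp neg_sq u); [apply is_derive_neg_sq|now apply hu]. }
assert (dec : forall t, 0 < t -> u t < 0 -> u1 t <= 0).
{ intros t t0 ut; apply Rnot_lt_le; intros pos; apply (flux_pos d) in pos.
  assert (0 <= - (flux d u1 t * neg_sq (u t))).
  { apply (ge_limit_of_derive (fun t => - (flux d u1 t * neg_sq (u t)))
      (fun t => - (2 * Rmin (u t) 0 * Rpower t (d - 1) * u1 t ^ 2))); [easy| | |].
    - intros y hy; apply (is_derive_opp (fun t => flux d u1 t * neg_sq (u t))).
      eapply is_derive_eq.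
      { apply (is_derive_mult (flux d u1) (fun t => neg_sq (u t))).
        - apply hu; lra.
        - apply dm; lra.
        - intros; apply Rmult_comm. }
      assert (z : clamp M (u y) * Rmin (u y) 0 = 0).
      { destruct (Rle_or_lt (u y) 0).
        - rewrite clamp_neg by easy; ring.
        - rewrite Rmin_right by lra; ring. }
      unfold plus, mult, flux, neg_sq; simpl.
      transitivity (2 * Rmin (u y) 0 * Rpower y (d - 1) * (u1 y * (u1 y * 1)) +
        Rpower y (d - 1) * (V y - 1) * Rmin (u y) 0 * (clamp M (u y) * Rmin (u y) 0));
        [ring_R|rewrite z; ring_R].
    - replace 0 with (-1 * (0 * neg_sq (u 0)) + 0 * (0 * neg_sq (u 0))) at 2 by ring.
      apply filterlim_ext with (fun t => -1 * (flux d u1 t * neg_sq (u t)) +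
        0 * (flux d u1 t * neg_sq (u t))); [intros; ring_R|].
      assert (l : filterlim (fun t => flux d u1 t * neg_sq (u t)) (at_right 0)
        (locally (0 * neg_sq (u 0)))).
      { eapply filterlim_comp_2; [apply hu| |apply (filterlim_mult 0 (neg_sq (u 0)))].
        eapply filterlim_comp; [apply hu|].
        apply (ex_derive_continuous neg_sq); eexists; apply is_derive_neg_sq. }
      now apply at_right_0_lincomb.
    - intros y hy; pose proof (Rmin_r (u y) 0); pose proof (pow2_ge_0 (u1 y)).
      pose proof (Rpower_pos y (d - 1)).
      assert (0 <= Rpower y (d - 1) * u1 y ^ 2) by (apply Rmult_le_pos; lra).
      nra. }
  assert (0 < neg_sq (u t)) by (unfold neg_sq; rewrite Rmin_left by lra; nra).
  nra. }
assert (mono : neg_sq (u x) <= neg_sq (u r)).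
{ apply (nondecreasing_of_derive (fun t => neg_sq (u t))
    (fun t => u1 t * (2 * Rmin (u t) 0))); [lra| |].
  - intros t ht; apply dm; lra.
  - intros t ht; destruct (Rlt_or_le (u t) 0) as [neg | pos].
    + rewrite Rmin_left by lra; specialize (dec t ltac:(lra) neg); nra.
    + rewrite Rmin_right by lra; lra. }
apply dec; [lra|]; apply Rnot_le_lt; intros ur; unfold neg_sq in mono.
rewrite (Rmin_left (u x)), (Rmin_right (u r)) in mono by lra; nra.
Qed.

(** A positive derivative at [t] persists at all later points, whereas a negative value at [x]
    forces [u1 <= 0] from [x] on; the two clash at [Rmax x t]. *)
Lemma truncated_dichotomy (d M a x s r : R) (u V : R -> R) : 0 < d -> 0 <= M -> 0 < a ->
  truncated_solution d M a u V -> 0 <= x -> u x < 0 -> 0 <= s < r -> u r <= u s.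
Proof.
intros d0 M0 a0 ts x0 ux sr.
destruct (radial_of_truncated_solution d M a u V d0 ts) as [u1 [V1 [hu [hV [i0 j0]]]]].
assert (xp : 0 < x) by (destruct x0 as [|<-]; lra).
apply Ropp_le_cancel.
apply (nondecreasing_on_half_line (fun t => - u t) (fun t => - u1 t)); [| |lra|].
- intros t t0; apply (is_derive_opp u), hu, t0.
- eapply filterlim_comp; [apply hu|apply (filterlim_opp (u 0))].
- intros t ht; enough (~ 0 < u1 t) by lra; intros pos.
  pose proof (Rmax_l x t); pose proof (Rmax_r x t).
  assert (0 < u1 (Rmax x t)).
  { apply (flux_stays_positive d u u1 V V1 (fun r => clamp M (u r)) t); try easy; [|lra].
    intros; now apply clamp_bounds. }
  pose proof (truncated_stays_negative d M x (Rmax x t) u u1 V hu ltac:(lra) ux); lra.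
Qed.

Lemma small_multiple (e eps : R) : 0 < eps -> exists eta, 0 < eta /\ forall h, Rabs h <= eta ->
  Rabs h * e < eps.
Proof.
intros e0; pose proof (Rabs_pos e); pose proof (Rle_abs e).
assert (p : 0 < eps / (Rabs e + 1)) by (apply Rdiv_lt_0_compat; lra).
exists (eps / (Rabs e + 1)); split; [easy|]; intros h hh.
pose proof (Rabs_pos h).
apply Rle_lt_trans with (eps / (Rabs e + 1) * Rabs e).
- apply Rle_trans with (Rabs h * Rabs e).
  + now apply Rmult_le_compat_l.
  + now apply Rmult_le_compat_r.
- replace eps with (eps / (Rabs e + 1) * (Rabs e + 1)) at 2 by (field; lra); nra.
Qed.

(* The shooting parameter is the supremum of those [a] for which [u] takes a negative
   value: both "u takes a negative value" and "u increases somewhere" are open in [a]. *)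
Lemma G_inhabited (d : R) : 0 < d -> exists u0, G d u0.
Proof.
intros d0.
pose (M := 1 + 32 * (d + 2) / d).
assert (q : 0 < 32 * (d + 2) / d) by (apply Rdiv_lt_0_compat; lra).
assert (M1 : 1 < M) by (unfold M; lra).
destruct (truncated_solutions_exist d M d0 ltac:(lra)) as [U [V [E [ts dep]]]].
pose (A := fun a => exists r, 0 <= r /\ U a r < 0).
(* If the solution started at [1/2] stays nonnegative, it is nonincreasing because [1/2 < 1], and
   [1/2] itself lies in [G]; otherwise the set whose supremum is taken is nonempty. *)
destruct (classic (A (/ 2))) as [Ahalf | nA].
2: { assert (nn : forall r, 0 <= r -> 0 <= U (/ 2) r).
  { intros r r0; apply Rnot_lt_le; intros lt; apply nA; now exists r. }
  exists (/ 2); apply (G_of_nonincreasing d M _ (U (/ 2)) (V (/ 2))); try easy; [lra|].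
  intros s r sr.
  apply (truncated_nonincreasing_of_lt_1 d M (/ 2) _ (V (/ 2))); try easy; lra. }
pose (S := fun a => / 2 <= a <= M /\ A a).
destruct (completeness S) as [a [ub lub]].
{ exists M; intros y [hy _]; lra. }
{ exists (/ 2); split; [lra|easy]. }
assert (a_ge : / 2 <= a) by (apply ub; split; [lra|easy]).
assert (a_le : a <= M) by (apply lub; intros y [hy _]; lra).
assert (disj : forall b x s r, / 2 <= b -> 0 <= x -> U b x < 0 -> 0 <= s < r -> U b r <= U b s).
{ intros b x s r hb; apply (truncated_dichotomy d M b x s r (U b) (V b)); try easy; lra. }
assert (notA : ~ A a).
{ intros [r [r0 neg]].
  (* Below [M], a negative value persists for slightly larger parameters, against the supremum; at
     [M], it would make the solution nonincreasing, which the size of [M] excludes. *)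
  destruct a_le as [a_lt | ->].
  - destruct (small_multiple (E r) (- U a r) ltac:(lra)) as [eta [eta0 h]].
    pose (b := a + Rmin eta (M - a)).
    pose proof (Rmin_l eta (M - a)); pose proof (Rmin_r eta (M - a)).
    assert (0 < Rmin eta (M - a)) by (apply Rmin_glb_lt; lra).
    assert (S b); [|specialize (ub b H2); unfold b in ub; lra].
    split; [unfold b; lra|]; exists r; split; [easy|].
    specialize (dep b a r r0); specialize (h (b - a)).
    assert (Rabs (b - a) <= eta).
    { unfold b; rewrite Rabs_right; lra. }
    assert (Rabs (U b r - U a r) < - U a r) as k by (specialize (h H2); lra).
    apply Rabs_def2 in k; lra.
  - apply (truncated_not_nonincreasing d M (U M) (V M) d0 ltac:(unfold M; lra) (ts M)).
    intros s t [s0 [st | ->]]; [|lra].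
    now apply (disj M r s t). }
exists a; apply (G_of_nonincreasing d M a (U a) (V a)); try easy; [lra| |].
- intros r r0; apply Rnot_lt_le; intros lt; apply notA; now exists r.
- intros s r sr; apply Rnot_lt_le; intros lt.
  assert (sr' : s < r) by (destruct sr as [? [| ->]]; lra).
  (* Parameters close to [a] move each of the two values by less than half of the increase, so their
     solutions increase from [s] to [r] too; yet some of them lie in [S], where solutions are
     nonincreasing. *)
  pose (g := (U a r - U a s) / 2).
  destruct (small_multiple (E r) g ltac:(unfold g; lra)) as [eta [eta0 h]].
  destruct (small_multiple (E s) g ltac:(unfold g; lra)) as [eta' [eta'0 h']].
  assert (m0 : 0 < Rmin eta eta') by now apply Rmin_glb_lt.
  pose proof (Rmin_l eta eta'); pose proof (Rmin_r eta eta').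
  destruct (classic (exists b, S b /\ a - Rmin eta eta' < b)) as [[b [Sb hb]] | none].
  + pose proof (ub b Sb) as ba; destruct Sb as [hb' [x [x0 neg]]].
    pose proof (disj b x s r ltac:(lra) x0 neg ltac:(lra)) as le.
    pose proof (dep b a r ltac:(lra)) as dr; pose proof (dep b a s ltac:(lra)) as ds.
    specialize (h (b - a)); specialize (h' (b - a)).
    assert (k : Rabs (b - a) <= Rmin eta eta') by (apply Rabs_le; lra).
    specialize (h ltac:(lra)); specialize (h' ltac:(lra)).
    assert (k1 : Rabs (U b r - U a r) < g) by lra.
    assert (k2 : Rabs (U b s - U a s) < g) by lra.
    apply Rabs_def2 in k1; apply Rabs_def2 in k2; unfold g in *; lra.
  + assert (a <= a - Rmin eta eta'); [|lra].
    apply lub; intros y Sy; apply Rnot_lt_le; intros yl; apply none; now exists y.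
Qed.

Theorem theorem3p6 : forall d : R, 0 < d -> exists! u0 : R, G d u0.
Proof.
intros d d0; destruct (G_inhabited d d0) as [u0 Gu]; exists u0; split; [easy|].
intros v0 Gv.
destruct (ground_state_of_G d u0 d0 Gu) as [u [u1 [P [P1 gu]]]].
destruct (ground_state_of_G d v0 d0 Gv) as [v [v1 [Q [Q1 gv]]]].
destruct (Rtotal_order u0 v0) as [lt | [eq | gt]]; [exfalso|easy|exfalso].
- exact (ground_state_unique d u0 v0 u u1 P P1 v v1 Q Q1 d0 gu gv lt).
- exact (ground_state_unique d v0 u0 v v1 Q Q1 u u1 P P1 d0 gv gu gt).
Qed.
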